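(* The Lie superalgebra $\mathfrak g''=SKO''(n,n+1;\lambda,\underline t)$ is spanned over $\mathbb F$ by $\{D_{KO}(1)\}\cup S_1\cup S_2\cup S_3\cup S_4\cup S_5$.
   Context: Setting. $\mathbb F$ is a field of characteristic $p>3$, $n\ge 3$ is an integer, $\underline t=(t_1,\dots,t_n)$ is a tuple of positive integers, $\lambda\in\mathbb F$. Put $\pi_i=p^{t_i}-1$, $\mathbb A=\{\alpha\in\mathbb N_0^n:\alpha_i\le\pi_i\ \forall i\}$, $|\alpha|=\sum_i\alpha_i$, and let $\varepsilon_i$ be the $i$-th unit vector. $\mathcal O(n;\underline t)$ is the divided power algebra with basis $x^{(\alpha)}$, $\alpha\in\mathbb A$, and product $x^{(\alpha)}x^{(\beta)}=\binom{\alpha+\beta}{\alpha}x^{(\alpha+\beta)}$ (with $x^{(\gamma)}=0$ if $\gamma\notin\mathbb A$); $x_i:=x^{(\varepsilon_i)}$. $\mathcal O=\mathcal O(n;\underline t)\otimes\Lambda$, where $\Lambda$ is the exterior superalgebra in odd variables $x_{n+1},\dots,x_{2n+1}$; $\mathrm p(a)\in\mathbb Z_2$ is the parity, and formulas involving $\mathrm p(a)$ are stated for homogeneous $a$ and extended linearly. $\partial_r$ ($1\le r\le 2n+1$) is the superderivation of $\mathcal O$ (even for $r\le n$, odd for $r>n$) with $\partial_r(x^{(\alpha)})=x^{(\alpha-\varepsilon_r)}$ for $r\le n$ and $\partial_r(x_s)=\delta_{rs}$. Put $i'=i+n$ for $1\le i\le n$, $i'=i-n$ for $n+1\le i\le 2n$;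 $\mu(i)=0$ for $i\le n$ and $\mu(i)=1$ for $n+1\le i\le 2n+1$; $\mathfrak D=\sum_{i=1}^{2n}x_i\partial_i$; $\Delta_i=\partial_i\partial_{i'}$ and $\Delta=\sum_{i=1}^n\Delta_i$. For $a\in\mathcal O$ let $T_H(a)=\sum_{i=1}^{2n}(-1)^{\mu(i')\mathrm p(a)}\partial_{i'}(a)\partial_i$, $D_{KO}(a)=T_H(a)+(-1)^{\mathrm p(a)}\partial_{2n+1}(a)\mathfrak D+(\mathfrak D(a)-2a)\partial_{2n+1}$, and $\mathrm{div}_\lambda(a)=(-1)^{\mathrm p(a)}2\big(\Delta(a)+(\mathfrak D-n\lambda\,\mathrm{id})\partial_{2n+1}(a)\big)$. Then $KO(n,n+1;\underline t)=\{D_{KO}(a):a\in\mathcal O\}$ is a Lie superalgebra of superderivations of $\mathcal O$, and $\mathfrak g''=SKO''(n,n+1;\lambda,\underline t)=\{D_{KO}(a):a\in\mathcal O,\ \mathrm{div}_\lambda(a)=0\}$ is a subalgebra. Monomial notation. Below $x^{(\alpha)}x^u$ always means $\alpha\in\mathbb A$ and $u=\langle i_1,\dots,i_k\rangle$ with $n+1\le i_1<\dots<i_k\le 2n$, $k\ge0$, $x^u=x_{i_1}\cdots x_{i_k}$, $|u|=k$; $u=0$ denotes the empty sequence. $\mathrm{zd}(x^{(\alpha)}x^u)=|\alpha|+|u|$. For $1\le i,j\le n$: $\nabla_i(x^{(\alpha)}x^u)=x^{(\alpha+\varepsilon_i)}x_{i'}x^u$ (linear operator; zero if $\alpha_i=\pi_i$),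 $\Gamma_i^j=\nabla_j\Delta_i$. $I(\alpha,u)=\{1\le i\le n:\Delta_i(x^{(\alpha)}x^u)\ne0\}$, $\widetilde I(\alpha,u)=\{1\le i\le n:\nabla_i(x^{(\alpha)}x^u)\neq0\}$; $\mathcal D^*$ is the set of $x^{(\alpha)}x^u$ with both $I(\alpha,u)$ and $\widetilde I(\alpha,u)$ nonempty; $q_{(\alpha,u)}=\min\widetilde I(\alpha,u)$ if $\widetilde I(\alpha,u)\neq\emptyset$. For $q\in\widetilde I(\alpha,u)$ put $A(\alpha,u,q)=x^{(\alpha)}x^u-\sum_{i\in I(\alpha,u)}\Gamma_i^q(x^{(\alpha)}x^u)$ and $B(\alpha,u,\lambda,q)=(-1)^{|u|}(n\lambda-\mathrm{zd}(x^{(\alpha)}x^u))\nabla_q(x^{(\alpha)}x^u)$. The sets are: $S_1=\{D_{KO}(x^{(\alpha)}x^u): I(\alpha,u)=\emptyset,\ (\alpha,u)\ne(0,0)\}$; $S_2=\{D_{KO}(A(\alpha,u,q)): x^{(\alpha)}x^u\in\mathcal D^*,\ q\in\widetilde I(\alpha,u)\}$; $S_3=\{D_{KO}(x^{(\alpha)}x^ux_{2n+1}+B(\alpha,u,\lambda,q_{(\alpha,u)})): I(\alpha,u)=\emptyset,\ \widetilde I(\alpha,u)\neq\emptyset\}$; $S_4=\{D_{KO}(A(\alpha,u,q)x_{2n+1}+B(\alpha,u,\lambda,q)): x^{(\alpha)}x^u\in\mathcal D^*,\ q\in\widetilde I(\alpha,u)\}$; $S_5=\{D_{KO}(x^{(\alpha)}x^ux_{2n+1}):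 I(\alpha,u)=\widetilde I(\alpha,u)=\emptyset,\ n\lambda-\mathrm{zd}(x^{(\alpha)}x^u)=0\text{ in }\mathbb F\}$. *)

(* Defs.v *)
From HB Require Import structures.
From mathcomp Require Import all_boot all_order all_algebra.
From mathcomp Require Import ring zify.

Set Implicit Arguments.
Unset Strict Implicit.
Unset Printing Implicit Defensive.
Import Order.TTheory GRing.Theory.
Local Open Scope ring_scope.

(* Indices start at 0.  The even variable x_(i+1) is indexed by [inl i] with
   [i : 'I_n], the odd variable x_(n+1+j) by [inr j] with [j : 'I_n.+1]; thus
   x_(2n+1) has the index [inr ord_max]. *)
Definition var (n : nat) : Type := ('I_n + 'I_n.+1)%type.

Definition pi_ (p n : nat) (t : 'I_n -> nat) (i : 'I_n) : nat := (p ^ t i).-1.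

Definition expo (p n : nat) (t : 'I_n -> nat) : Type :=
  {dffun forall i : 'I_n, 'I_(pi_ p t i).+1}.

Definition bidx (p n : nat) (t : 'I_n -> nat) : Type :=
  (expo p t * {set 'I_n.+1})%type.

HB.instance Definition _ (p n : nat) (t : 'I_n -> nat) :=
  Finite.copy (expo p t) {dffun forall i : 'I_n, 'I_(pi_ p t i).+1}.
HB.instance Definition _ (p n : nat) (t : 'I_n -> nat) :=
  Finite.copy (bidx p t) (expo p t * {set 'I_n.+1})%type.

Definition superO (F : fieldType) (p n : nat) (t : 'I_n -> nat) : Type :=
  {ffun bidx p t -> F^o}.

HB.instance Definition _ (F : fieldType) (p n : nat) (t : 'I_n -> nat) :=
  Vector.copy (superO F p t) {ffun bidx p t -> F^o}.

Section SuperAlgebra.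
Variables (F : fieldType) (p n : nat) (t : 'I_n -> nat).
Local Notation O := (superO F p t).
Implicit Types (a b c : O) (al be ga : 'I_n -> nat) (u v w : {set 'I_n.+1}).

(* The monomial x^(al) x^u, which is 0 when al i > pi_ p t i for some i. *)
Definition mono al u : O :=
  [ffun k : bidx p t => ([forall i, k.1 i == al i :> nat] && (k.2 == u))%:R].

Definition bmono (k : bidx p t) : O := mono (fun i => k.1 i : nat) k.2.

Definition lext (V : lmodType F) (f : bidx p t -> V) a : V :=
  \sum_k (a k : F) *: f k.

Lemma lext_is_linear (V : lmodType F) f : linear (@lext V f).
Proof.
move=> x a b; rewrite /lext scaler_sumr -big_split /=; apply: eq_bigr => k _.
by rewrite scalerA -scalerDl !ffunE.
Qed.

HB.instance Definition _ (V : lmodType F) f :=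
  GRing.isLinear.Build F O V *:%R (@lext V f) (lext_is_linear f).

(* The number of transpositions of odd variables that sort x^u x^v. *)
Definition inver u v : nat := \sum_(i in u) \sum_(j in v) (j < i).

Definition mono_coef al be u v : F :=
  if [disjoint u & v]
  then (-1) ^+ inver u v * (\prod_i 'C(al i + be i, al i))%:R else 0.

Definition mono_mul (k l : bidx p t) : O :=
  mono_coef (fun i => k.1 i : nat) (fun i => l.1 i : nat) k.2 l.2
    *: mono (fun i => k.1 i + l.1 i)%N (k.2 :|: l.2).

Definition superO_mul a b : O :=
  lext (fun k => lext (fun l => mono_mul k l) b) a.

Definition superO_one : O := mono (fun=> 0%N) set0.

Lemma bmonoE k l : bmono k l = (l == k)%:R.
Proof.
rewrite ffunE; congr (nat_of_bool _)%:R.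
case: l k => [l1 l2] [k1 k2] /=; rewrite xpair_eqE; congr (_ && _).
apply/forallP/eqP => [h | -> //]; apply/ffunP => i.
by apply/val_inj/eqP/h.
Qed.

Lemma lext_bmono a : lext bmono a = a.
Proof.
apply/ffunP => l; rewrite /lext sum_ffunE (bigD1 l) //= big1 => [|k kl].
  by rewrite ffunE bmonoE eqxx addr0 /GRing.scale /= mulr1.
by rewrite ffunE bmonoE eq_sym (negbTE kl) /GRing.scale /= mulr0.
Qed.

Lemma lextE (V : lmodType F) (f : bidx p t -> V) k : lext f (bmono k) = f k.
Proof.
rewrite /lext (bigD1 k) //= big1 => [|l kl].
  by rewrite bmonoE eqxx scale1r addr0.
by rewrite bmonoE (negbTE kl) scale0r.
Qed.

Lemma eq_lext (V : lmodType F) (f g : bidx p t -> V) a :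
  f =1 g -> lext f a = lext g a.
Proof. by move=> e; apply: eq_bigr => k _; rewrite e. Qed.

Lemma lextD (V : lmodType F) (f g : bidx p t -> V) a :
  lext (fun k => f k + g k) a = lext f a + lext g a.
Proof.
by rewrite /lext -big_split; apply: eq_bigr => k _; rewrite scalerDr.
Qed.

Lemma lextZ (V : lmodType F) (x : F) (f : bidx p t -> V) a :
  lext (fun k => x *: f k) a = x *: lext f a.
Proof.
rewrite /lext scaler_sumr; apply: eq_bigr => k _.
by rewrite !scalerA mulrC.
Qed.

Lemma mono_case al u :
  (exists2 k, mono al u = bmono k & k.2 = u /\ forall i, k.1 i = al i :> nat)
  \/ (mono al u = 0 /\ exists i, (pi_ p t i < al i)%N).
Proof.
case: (boolP [forall i, al i < (pi_ p t i).+1]%N) => [/forallP h | /forallPn[i hi]].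
  left; exists ([ffun i => Ordinal (h i)] : expo p t, u).
    apply/ffunP => l; rewrite !ffunE /=; congr (nat_of_bool (_ && _))%:R.
    by apply: eq_forallb => i; rewrite ffunE.
  by split=> // i; rewrite ffunE.
right; split; last by exists i; rewrite leqNgt.
apply/ffunP => l; rewrite !ffunE; case: forallP => //= /(_ i)/eqP e.
by move: hi; rewrite -e ltn_ord.
Qed.

Lemma eq_mono al be u : al =1 be -> mono al u = mono be u.
Proof.
move=> e; apply/ffunP => l; rewrite !ffunE; congr (nat_of_bool (_ && _))%:R.
by apply: eq_forallb => i; rewrite e.
Qed.

Lemma mono_oob al u i : (pi_ p t i < al i)%N -> mono al u = 0.
Proof.
move=> hi; apply/ffunP => l; rewrite !ffunE; case: forallP => //= /(_ i)/eqP e.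
by move: hi; rewrite -e leqNgt ltn_ord.
Qed.

Lemma mono_coef_ext al be al' be' u v :
  al =1 al' -> be =1 be' -> mono_coef al be u v = mono_coef al' be' u v.
Proof.
move=> e e'; rewrite /mono_coef; case: ifP => // _; congr (_ * _%:R).
by apply: eq_bigr => i _; rewrite e e'.
Qed.

Lemma superO_mulDl : left_distributive superO_mul +%R.
Proof. by move=> a b c; rewrite /superO_mul linearD. Qed.

Lemma superO_mulDr : right_distributive superO_mul +%R.
Proof.
move=> a b c; rewrite -lextD; apply: eq_lext => k; exact: linearD.
Qed.

Lemma superO_scaleAl (x : F) a b :
  x *: superO_mul a b = superO_mul (x *: a) b.
Proof. by rewrite /superO_mul linearZ. Qed.

Lemma superO_scaleAr (x : F) a b :
  x *: superO_mul a b = superO_mul a (x *: b).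
Proof.
rewrite -lextZ; apply: eq_lext => k; symmetry; exact: linearZ.
Qed.

Lemma superO_mul_mono al be u v : superO_mul (mono al u) (mono be v) =
  mono_coef al be u v *: mono (fun i => al i + be i)%N (u :|: v).
Proof.
case: (mono_case al u) => [[k -> [<- ek]] | [-> [i hi]]]; last first.
  rewrite {1}/superO_mul raddf0 (@mono_oob _ _ i) ?scaler0 //.
  by rewrite (leq_trans hi) // leq_addr.
case: (mono_case be v) => [[l -> [<- el]] | [-> [i hi]]]; last first.
  rewrite /superO_mul lextE raddf0 (@mono_oob _ _ i) ?scaler0 //.
  by rewrite (leq_trans hi) // leq_addl.
rewrite /superO_mul !lextE /mono_mul (mono_coef_ext _ _ ek el); congr (_ *: _).
by apply: eq_mono => i; rewrite ek el.
Qed.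

Lemma superO_ind (P : O -> Prop) : P 0 -> (forall a b, P a -> P b -> P (a + b)) ->
  (forall (x : F) al u, P (x *: mono al u)) -> forall a, P a.
Proof.
by move=> P0 PD PZ a; rewrite -[a]lext_bmono; apply: big_ind => // k _; apply: PZ.
Qed.

Lemma superO_mul0r a : superO_mul 0 a = 0.
Proof. by rewrite /superO_mul raddf0. Qed.

Lemma superO_mulr0 a : superO_mul a 0 = 0.
Proof. by have := superO_scaleAr 0 a 0; rewrite !scale0r. Qed.

Lemma superO_mul1r : left_id superO_one superO_mul.
Proof.
move=> a; elim/superO_ind: a => [|a b ea eb|x al u]; first exact: superO_mulr0.
  by rewrite superO_mulDr ea eb.
rewrite -superO_scaleAr superO_mul_mono set0U /mono_coef /inver big_set0 -setI_eq0.
rewrite set0I eqxx big1 => [|i _]; last by rewrite bin0.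
by rewrite mulr1 scale1r.
Qed.

Lemma superO_mulr1 : right_id superO_one superO_mul.
Proof.
move=> a; elim/superO_ind: a => [|a b ea eb|x al u]; first exact: superO_mul0r.
  by rewrite superO_mulDl ea eb.
rewrite -superO_scaleAl superO_mul_mono setU0 /mono_coef /inver big1; last first.
  by move=> i _; rewrite big_set0.
rewrite -setI_eq0 setI0 eqxx big1 => [|i _]; last by rewrite addn0 binn.
rewrite mulr1 scale1r; congr (_ *: _).
by apply: eq_mono => i; rewrite addn0.
Qed.

Lemma inverUl u v w : [disjoint u & v] ->
  inver (u :|: v) w = (inver u w + inver v w)%N.
Proof.
move=> d; rewrite /inver -bigU //; apply: eq_bigl => i.
by rewrite !inE.
Qed.

Lemma inverUr u v w : [disjoint v & w] ->
  inver u (v :|: w) = (inver u v + inver u w)%N.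
Proof.
move=> d; rewrite /inver -big_split; apply: eq_bigr => i _; rewrite -bigU //.
by apply: eq_bigl => j; rewrite !inE.
Qed.

Lemma bin_assoc i j k :
  ('C(i + (j + k), i) * 'C(j + k, j) = 'C(i + j, i) * 'C(i + j + k, i + j))%N.
Proof.
have h (x y : nat) : ('C(x + y, x) * (x`! * y`!) = (x + y)`!)%N.
  by rewrite -[in RHS](bin_fact (leq_addr y x)) addKn.
have f0 (x : nat) : (0 < x`!)%N := fact_gt0 x.
apply/eqP; rewrite -(eqn_pmul2r (m := i`! * (j`! * k`!))) ?muln_gt0 ?f0 //.
apply/eqP; transitivity ((i + j + k)`!).
  by rewrite -addnA -[in RHS]h -[in RHS](h j k); ring.
by rewrite -[in LHS]h -[in LHS](h i j); ring.
Qed.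

Lemma superO_mulA : associative superO_mul.
Proof.
move=> a b c; elim/superO_ind: a => [|a a' ea ea'|x al u].
- by rewrite !superO_mul0r.
- by rewrite !superO_mulDl ea ea'.
rewrite -!superO_scaleAl; congr (_ *: _).
elim/superO_ind: b => [|b b' eb eb'|y be v].
- by rewrite !(superO_mul0r, superO_mulr0).
- by rewrite !(superO_mulDl, superO_mulDr) eb eb'.
rewrite -!(superO_scaleAl, superO_scaleAr); congr (_ *: _).
elim/superO_ind: c => [|c c' ec ec'|z ga w].
- by rewrite !superO_mulr0.
- by rewrite !superO_mulDr ec ec'.
rewrite -!superO_scaleAr; congr (_ *: _).
rewrite !superO_mul_mono -superO_scaleAr -superO_scaleAl !superO_mul_mono.
rewrite !scalerA setUA; congr (_ *: _); last first.
  by apply: eq_mono => i; rewrite addnA.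
rewrite /mono_coef -!setI_eq0 setIUr setIUl !setU_eq0 !setI_eq0.
case: (boolP [disjoint u & v]) => uv; case: (boolP [disjoint v & w]) => vw;
  rewrite ?(andbF, andbT) ?(mul0r, mulr0) //=.
case: ifP => uw; last by rewrite !mulr0.
rewrite inverUl // inverUr // !exprD mulrACA [RHS]mulrACA; congr (_ * _).
  by rewrite [LHS]mulrC -mulrA.
rewrite -!natrM; congr (_%:R); rewrite -!big_split /=; apply: eq_bigr => i _.
by rewrite mulnC bin_assoc.
Qed.

Lemma superO_one_neq0 : superO_one != 0.
Proof.
case: (mono_case (fun=> 0%N) set0) => [[k e _] | [_ [i]]]; last by rewrite ltn0.
apply/eqP => /ffunP/(_ k); rewrite /superO_one e bmonoE eqxx ffunE.
by apply/eqP/oner_neq0.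
Qed.

HB.instance Definition _ := GRing.Zmodule_isNzRing.Build O
  superO_mulA superO_mul1r superO_mulr1 superO_mulDl superO_mulDr
  superO_one_neq0.
HB.instance Definition _ := GRing.Lmodule_isLalgebra.Build F O superO_scaleAl.
HB.instance Definition _ := GRing.Lalgebra_isAlgebra.Build F O superO_scaleAr.

Lemma monoM al be u v : mono al u * mono be v =
  mono_coef al be u v *: mono (fun i => al i + be i)%N (u :|: v).
Proof. exact: superO_mul_mono. Qed.

Definition xvar (r : var n) : O :=
  match r with
  | inl i => mono (fun l => (l == i) : nat) set0
  | inr j => mono (fun=> 0%N) [set j]
  end.

Lemma monoE al u : mono al u = mono al set0 * \prod_(j in u) xvar (inr j).
Proof.
suff -> : \prod_(j in u) xvar (inr j) = mono (fun=> 0%N) u.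
  rewrite monoM set0U /mono_coef /inver big_set0 -setI_eq0 set0I eqxx big1; last first.
    by move=> i _; rewrite addn0 binn.
  by rewrite mulr1 scale1r; apply: eq_mono => i; rewrite addn0.
rewrite -big_filter; set s := [seq j <- _ | _].
have -> : u = [set j in s].
  by apply/setP=> j; rewrite inE mem_filter mem_index_enum andbT.
have : sorted ltn (map val s).
  apply: (subseq_sorted ltn_trans (s2 := map val (index_enum 'I_n.+1))).
    exact/map_subseq/filter_subseq.
  by rewrite [index_enum _]unlock -enumT val_enum_ord iota_ltn_sorted.
elim: s => [|j s IH] /=.
  rewrite big_nil; suff -> : [set j in [::]] = set0 :> {set 'I_n.+1} by [].
  by apply/setP => j; rewrite !inE.
move=> js; rewrite big_cons IH ?(path_sorted js) // monoM.
have {}js l : l \in s -> (j < l)%N.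
  move=> ls; have /allP := order_path_min ltn_trans js.
  by apply; apply: map_f.
rewrite /mono_coef disjoints1 inE; case: ifPn => [_|]; last first.
  by rewrite negbK => /js; rewrite ltnn.
rewrite /inver big_set1 big1 => [|l]; last first.
  by rewrite inE => /js jl; rewrite ltnNge ltnW.
rewrite big1 // mulr1 scale1r; congr (mono _ _).
by apply/setP => l; rewrite !inE.
Qed.

(* The sign comes from moving x_(n+1+j) to the front of x^u.  Lemmas dvar_even,
   dvar_xvar and dvarM show that dvar r is the superderivation d/dx_r. *)
Definition dvar_basis (r : var n) (k : bidx p t) : O :=
  match r with
  | inl i => if k.1 i == 0%N :> nat then 0
             else mono (fun l => k.1 l - (l == i))%N k.2
  | inr j => if j \in k.2
             then (-1) ^+ #|[set l in k.2 | (l < j)%N]|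
                    *: mono (fun l => k.1 l : nat) (k.2 :\ j)
             else 0
  end.

Definition dvar (r : var n) : 'End(O) := linfun (lext (dvar_basis r)).

Lemma dvar_even i al u : (al i <= pi_ p t i)%N ->
  dvar (inl i) (mono al u) =
  if al i == 0%N then 0 else mono (fun l => al l - (l == i))%N u.
Proof.
move=> hi; rewrite lfunE /=.
case: (mono_case al u) => [[k -> [<- ek]] | [-> [j hj]]].
  by rewrite lextE /dvar_basis ek; case: ifP => // _; apply: eq_mono => l; rewrite ek.
rewrite raddf0; case: ifP => // _; rewrite (@mono_oob _ _ j) //.
case: eqP => [e|_]; last by rewrite subn0.
by move: hj; rewrite e ltnNge hi.
Qed.

Lemma dvar_odd j al u : dvar (inr j) (mono al u) =
  if j \in u then (-1) ^+ #|[set l in u | (l < j)%N]| *: mono al (u :\ j)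
  else 0.
Proof.
rewrite lfunE /=.
case: (mono_case al u) => [[k -> [<- ek]] | [-> [i hi]]].
  by rewrite lextE /dvar_basis; case: ifP => // _; congr (_ *: _); apply: eq_mono.
by rewrite raddf0; case: ifP => // _; rewrite (@mono_oob _ _ i) ?scaler0.
Qed.

Lemma dvar_xvar r s : p \in [pchar F] -> (forall i, (0 < t i)%N) ->
  dvar r (xvar s) = (r == s)%:R.
Proof.
move=> hp ht.
have hpi i : (0 < pi_ p t i)%N.
  rewrite /pi_ -subn1 subn_gt0 -(exp1n (t i)) ltn_exp2r //.
  exact/prime_gt1/(pcharf_prime hp).
case: r s => [i|j] [l|m] /=.
- rewrite dvar_even; last by case: eqP => // _; apply: hpi.
  rewrite (_ : (inl i == inl l) = (i == l)) //.
  case: (eqVneq i l) => [->|] //=.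
  transitivity (mono (fun=> 0%N) set0); last by [].
  by apply: eq_mono => k; rewrite subnn.
- by rewrite dvar_even.
- by rewrite dvar_odd inE.
rewrite dvar_odd inE (_ : (inr j == inr m) = (j == m)) //.
case: (eqVneq j m) => [->|] //=.
rewrite setDv (_ : [set _ in _ | _] = set0) ?cards0 ?scale1r //.
by apply/setP => k; rewrite !inE; case: eqP => // ->; rewrite ltnn.
Qed.

Lemma inver1l j v : inver [set j] v = #|[set l in v | (l < j)%N]|.
Proof.
rewrite /inver big_set1 -sum1_card big_mkcond [RHS]big_mkcond /=.
by apply: eq_bigr => l _; rewrite inE; case: (l \in v) => //=; case: ifP.
Qed.

Lemma inver1r u j : inver u [set j] = #|[set l in u | (j < l)%N]|.
Proof.
rewrite /inver -sum1_card big_mkcond [RHS]big_mkcond /=.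
by apply: eq_bigr => l _; rewrite inE big_set1; case: (l \in u) => //=; case: ifP.
Qed.

Lemma card_split u j : j \in u ->
  #|u| = (#|[set l in u | (l < j)%N]| + #|[set l in u | (j < l)%N]|).+1.
Proof.
move=> ju; rewrite (cardsD1 j) ju add1n; congr _.+1.
rewrite -(cardsID [set l : 'I_n.+1 | (l < j)%N]); congr (_ + _)%N;
  apply: eq_card => l; rewrite !inE.
  by case: (eqVneq l j) => [->|]; rewrite ?ltnn ?andbF.
by rewrite -leqNgt -val_eqE /=; case: (ltngtP j l); rewrite ?andbF ?andbT.
Qed.

Lemma dvarM_even i al be u v : p \in [pchar F] ->
  (forall l, (al l <= pi_ p t l)%N) -> (forall l, (be l <= pi_ p t l)%N) ->
  dvar (inl i) (mono al u * mono be v) =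
    dvar (inl i) (mono al u) * mono be v + mono al u * dvar (inl i) (mono be v).
Proof.
move=> hp hal hbe; rewrite monoM linearZ /= (dvar_even _ (hal i)) (dvar_even _ (hbe i)).
set g := fun l => (al l + be l - (l == i))%N.
have hg f f' : (f =1 g) -> mono f f' = mono g f' by move=> e; apply: eq_mono.
have eL : (if al i == 0%N then 0 else mono (fun l => al l - (l == i))%N u) * mono be v
   = (if al i == 0%N then 0 else mono_coef (fun l => al l - (l == i))%N be u v) *: mono g (u :|: v).
  case: ifPn => h; first by rewrite mul0r scale0r.
  rewrite monoM; congr (_ *: _); apply: eq_mono => l; rewrite /g.
  by rewrite addnBAC //; case: eqP => // ->; rewrite lt0n.
have eR : mono al u * (if be i == 0%N then 0 else mono (fun l => be l - (l == i))%N v)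
   = (if be i == 0%N then 0 else mono_coef al (fun l => be l - (l == i))%N u v) *: mono g (u :|: v).
  case: ifPn => h; first by rewrite mulr0 scale0r.
  rewrite monoM; congr (_ *: _); apply: eq_mono => l; rewrite /g.
  by rewrite addnBA //; case: eqP => // ->; rewrite lt0n.
rewrite eL eR -scalerDl {eL eR}.
set P := (\prod_(l < n | l != i) 'C(al l + be l, al l))%N.
have E0 : mono_coef al be u v =
    mono_coef (fun=> 0%N) (fun=> 0%N) u v * (P * 'C(al i + be i, al i))%:R.
  rewrite /mono_coef; case: ifP; rewrite ?mul0r // => _; rewrite -mulrA; congr (_ * _).
  by rewrite [X in X%:R * _]big1 ?mul1r // (bigD1 i) //= mulnC.
have E1 : (if al i == 0%N then 0 else mono_coef (fun l => al l - (l == i))%N be u v) =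
    mono_coef (fun=> 0%N) (fun=> 0%N) u v *
      (P * (if al i == 0 then 0 else 'C((al i + be i).-1, (al i).-1)))%:R.
  case: ifPn => h; first by rewrite muln0 mulr0.
  rewrite /mono_coef; case: ifP; rewrite ?mul0r // => _; rewrite -mulrA; congr (_ * _).
  rewrite [X in X%:R * _]big1 ?mul1r // (bigD1 i) //= mulnC eqxx !subn1.
  congr (_ * _)%:R; last by congr 'C(_, _); move: h; case: (al i).
  by apply: eq_bigr => l /negbTE ->; rewrite subn0.
have E2 : (if be i == 0%N then 0 else mono_coef al (fun l => be l - (l == i))%N u v) =
    mono_coef (fun=> 0%N) (fun=> 0%N) u v *
      (P * (if be i == 0 then 0 else 'C((al i + be i).-1, al i)))%:R.
  case: ifPn => h; first by rewrite muln0 mulr0.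
  rewrite /mono_coef; case: ifP; rewrite ?mul0r // => _; rewrite -mulrA; congr (_ * _).
  rewrite [X in X%:R * _]big1 ?mul1r // (bigD1 i) //= mulnC eqxx !subn1.
  congr (_ * _)%:R; last by congr 'C(_, _); move: h; case: (be i) => // m; rewrite addnS.
  by apply: eq_bigr => l /negbTE ->; rewrite subn0.
rewrite E0 E1 E2 -mulrDr -natrD -mulnDr.
set y := (X in _ = _ * (P * X)%:R *: mono g _).
have ey : (0 < al i + be i)%N -> y = 'C(al i + be i, al i).
  rewrite /y; case: (al i) => [|x]; case: (be i) => [|z] // _ /=.
  - by rewrite !bin0.
  - by rewrite !addn0 !binn.
  - by rewrite !addSn /= binS addnC addnS.
have [z0|gt0] := posnP (al i + be i)%N.
  move/eqP: z0; rewrite addn_eq0 => /andP[/eqP a0 /eqP b0].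
  rewrite /y a0 b0 /= muln0 mulr0 scale0r dvar_even ?a0 ?b0 //= scaler0 //.
rewrite ey //.
case: (leqP (al i + be i) (pi_ p t i)) => hgi.
  by rewrite dvar_even //; move: gt0; rewrite lt0n => /negbTE ->.
rewrite (@mono_oob _ _ i) // raddf0 scaler0.
have pp := pcharf_prime hp.
case: (eqVneq (al i + be i)%N (p ^ t i)%N) => e; last first.
  rewrite (@mono_oob _ _ i) ?scaler0 // /g eqxx subn1.
  have p0 : (0 < p ^ t i)%N by rewrite expn_gt0 prime_gt0.
  by move: hgi e; rewrite /pi_; lia.
have : (p %| 'C(al i + be i, al i))%N.
  have [a0 an] : (0 < al i)%N /\ (al i < p ^ t i)%N.
    by move: (hal i) (hbe i) e; rewrite /pi_; lia.
  rewrite e; apply: contraLR an => pC; rewrite -leqNgt; apply: dvdn_leq => //.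
  have cop : coprime (p ^ t i) 'C(p ^ t i, al i).
    by apply: coprimeXl; rewrite prime_coprime.
  by rewrite -(Gauss_dvdl _ cop) -(prednK a0) -mul_bin_diag dvdn_mulr.
rewrite (dvdn_pcharf hp) natrM => /eqP ->.
by rewrite !mulr0 scale0r.
Qed.

Lemma dvarM_odd j al be u v : dvar (inr j) (mono al u * mono be v) =
  dvar (inr j) (mono al u) * mono be v
    + (-1) ^+ #|u| *: (mono al u * dvar (inr j) (mono be v)).
Proof.
rewrite monoM linearZ /= !dvar_odd.
set g := fun l => (al l + be l)%N.
set P : F := (\prod_i 'C(al i + be i, al i))%:R.
set U := inver u v; set ul := #|[set l in u | (l < j)%N]|.
set vl := #|[set l in v | (l < j)%N]|.
have eul : #|[set l in u :|: v | (l < j)%N]| =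
    (ul + vl - #|[set l in u :&: v | (l < j)%N]|)%N.
  rewrite (_ : [set l in u :|: v | _] =
    [set l in u | (l < j)%N] :|: [set l in v | (l < j)%N]); last first.
    by apply/setP => l; rewrite !inE andb_orl.
  rewrite cardsU; congr (_ - _)%N; apply: eq_card => l; rewrite !inE.
  by case: (l \in u); case: (l \in v); case: (l < j)%N.
have eU1 : j \in u -> U = (inver (u :\ j) v + vl)%N.
  move=> ju; rewrite /U -{1}(setD1K ju) inverUl ?inver1l 1?addnC //.
  by rewrite disjoints1 !inE eqxx.
have eU2 : j \in v ->
    U = (inver u (v :\ j) + #|[set l in u | (j < l)%N]|)%N.
  move=> jv; rewrite /U -{1}(setD1K jv) inverUr ?inver1r 1?addnC //.
  by rewrite disjoints1 !inE eqxx.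
have dis0 w w' : [disjoint w & w'] = (w :&: w' == set0) by rewrite setI_eq0.
case: (boolP [disjoint u & v]) => [duv|nduv]; last first.
  rewrite {1}/mono_coef (negbTE nduv) scale0r.
  case: (boolP ((j \in u) && (j \in v))) => [/andP[ju jv]|juv].
    rewrite ju jv -scalerAl -scalerAr !monoM !scalerA.
    have eUv : u :\ j :|: v = u :|: v.
      by apply/setP => l; rewrite !inE; case: eqP => // ->; rewrite jv !orbT.
    have euV : u :|: v :\ j = u :|: v.
      by apply/setP => l; rewrite !inE; case: eqP => // ->; rewrite ju !orTb.
    have edis : [disjoint u & v :\ j] = [disjoint u :\ j & v].
      by rewrite !dis0 setIDA setIDAC.
    rewrite eUv euV -scalerDl /mono_coef edis -/P.
    case: ifP => _; last by rewrite !mulr0 addr0 scale0r.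
    rewrite (_ : _ + _ = 0) ?scale0r //.
    rewrite (card_split ju) !mulrA -mulrDl -!exprD -/ul -/vl.
    apply/eqP; rewrite mulf_eq0; apply/orP; left; apply/eqP.
    have key (x y : nat) : odd x = ~~ odd y -> (-1) ^+ x + (-1) ^+ y = 0 :> F.
      move=> h; rewrite -signr_odd h -[X in _ + X]signr_odd.
      by case: (odd y); rewrite /= ?expr0 ?expr1; ring.
    apply: key; have := congr1 odd (eU1 ju).
    rewrite (eU2 jv) -[(ul + _).+1]addn1 !oddD [odd 1]/=.
    move: (odd ul) (odd vl) (odd (inver u _)) (odd (inver _ v)) (odd #|_|).
    by do 5!case.
  have hu : j \in u -> ~~ [disjoint u :\ j & v].
    move=> ju; apply: contra nduv; rewrite !dis0 => /eqP e; apply/eqP/setP => l.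
    have := congr1 (fun A : {set _} => l \in A) e; rewrite !inE.
    by case: eqP => [->|//] _; move: juv; rewrite ju => /negbTE ->.
  have hv : j \in v -> ~~ [disjoint u & v :\ j].
    move=> jv; apply: contra nduv; rewrite !dis0 => /eqP e; apply/eqP/setP => l.
    have := congr1 (fun A : {set _} => l \in A) e; rewrite !inE.
    by case: eqP => [->|//] _; move: juv; rewrite jv andbT => /negbTE ->.
  case: ifP => [/hu h1|_]; case: ifP => [/hv h2|_];
    rewrite -?scalerAl -?scalerAr ?monoM /mono_coef
      ?(negbTE h1) ?(negbTE h2) ?mul0r ?mulr0 ?scale0r ?scaler0 ?addr0 //.
have dI l : l \in u -> l \in v = false.
  by move=> lu; apply: (disjointFr duv).
have {}eul : #|[set l in u :|: v | (l < j)%N]| = (ul + vl)%N.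
  rewrite eul (_ : [set l in u :&: v | _] = set0) ?cards0 ?subn0 //.
  by apply/setP => l; rewrite !inE; case lu: (l \in u); rewrite // (dI l lu).
rewrite eul inE /mono_coef duv -/P -/U.
case: (boolP (j \in u)) => ju /=.
  rewrite (dI _ ju) mulr0 scaler0 addr0 -scalerAl monoM !scalerA /mono_coef -/P.
  rewrite (disjointWl (subD1set _ _) duv) (eU1 ju) setDUl.
  rewrite [v :\ j](_ : _ = v); last first.
    apply/setP => l; rewrite !inE.
    by case: eqP => [->|//]; rewrite (dI _ ju).
  congr (_ *: _); rewrite !exprD; rewrite [RHS]mulrA.
  have : (-1) ^+ vl * (-1) ^+ vl = 1 :> F by rewrite -exprMn mulrNN mul1r expr1n.
  by move: ((-1) ^+ vl) => x hx; rewrite -[RHS]mulr1 -hx; ring.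
case: (boolP (j \in v)) => jv; last by rewrite mul0r mulr0 !scaler0 addr0.
rewrite mul0r add0r -scalerAr monoM !scalerA /mono_coef -/P.
rewrite (disjointWr (subD1set _ _) duv) (eU2 jv) setDUl.
have uj : u :\ j = u.
  apply/setP => l; rewrite !inE.
  by case: eqP => [->|//]; rewrite (negbTE ju).
have cu : #|u| = (ul + #|[set l in u | (j < l)%N]|)%N.
  rewrite -(cardsID [set l : 'I_n.+1 | (l < j)%N]); congr (_ + _)%N;
    apply: eq_card => l; rewrite !inE //.
  rewrite andbC; case lu: (l \in u) => //=; rewrite -leqNgt leq_eqVlt.
  by case: eqP => // e; move: ju; rewrite (val_inj e : j = l) lu.
rewrite uj cu; congr (_ *: _); rewrite !exprD.
have : forall m, (-1) ^+ m * (-1) ^+ m = 1 :> F.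
  by move=> m; rewrite -exprMn mulrNN mul1r expr1n.
move/(_ #|[set l in u | (j < l)%N]|).
by move: ((-1) ^+ _) => x hx; ring.
Qed.

(* The component of a of parity e. *)
Definition par (e : bool) a : O :=
  [ffun k : bidx p t => if odd #|k.2| == e then a k else 0].

Definition mu (r : var n) : bool := if r is inr _ then true else false.

Lemma dvarM r e a b : p \in [pchar F] -> par e a = a ->
  dvar r (a * b) =
    dvar r a * b + (-1) ^+ (mu r * e) *: (a * dvar r b).
Proof.
move=> hp <-; rewrite -[b]lext_bmono /lext.
apply: (big_ind (fun b => dvar r (par e a * b) = dvar r (par e a) * b
    + (-1) ^+ (mu r * e) *: (par e a * dvar r b))).
- by rewrite mulr0 !linear0 !mulr0 scaler0 addr0.
- move=> b1 b2 e1 e2; rewrite mulrDr !linearD /= e1 e2 !mulrDr scalerDr.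
  by rewrite addrACA.
move=> l _; rewrite -[par e a]lext_bmono /lext.
apply: (big_ind (fun a => dvar r (a * (b l *: bmono l)) =
    dvar r a * (b l *: bmono l)
    + (-1) ^+ (mu r * e) *: (a * dvar r (b l *: bmono l)))).
- by rewrite mul0r !linear0 !mul0r scaler0 addr0.
- move=> a1 a2 e1 e2; rewrite mulrDl !linearD /= e1 e2 !mulrDl scalerDr.
  by rewrite addrACA.
move=> k _; rewrite ffunE; case: eqP => [<- | _]; last first.
  by rewrite !scale0r mul0r !linear0 !mul0r scaler0 addr0.
suff : dvar r (bmono k * bmono l) = dvar r (bmono k) * bmono l
    + (-1) ^+ (mu r * odd #|k.2|) *: (bmono k * dvar r (bmono l)).
  move=> h; rewrite !linearZ /= -!(scalerAl, scalerAr) linearZ /= linearZ /= h.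
  rewrite !scalerDr; congr (_ + _); rewrite !scalerA; congr (_ *: _); ring.
case: r => [i|j]; last by rewrite dvarM_odd mul1n signr_odd.
rewrite dvarM_even // => [|i'|i']; rewrite ?mul0n ?scale1r //.
  by rewrite -ltnS ltn_ord.
by rewrite -ltnS ltn_ord.
Qed.

(* The map i |-> i' on {1, ..., 2n} and the embedding of {1, ..., 2n} into
   the set of all indices. *)
Definition prime_ (s : 'I_n + 'I_n) : 'I_n + 'I_n :=
  match s with inl i => inr i | inr i => inl i end.

Definition wid (i : 'I_n) : 'I_n.+1 := widen_ord (leqnSn n) i.

Definition var2 (s : 'I_n + 'I_n) : var n :=
  match s with inl i => inl i | inr i => inr (wid i) end.

Definition vlast : var n := inr ord_max.

Definition lmulD a (D : 'End(O)) : 'End(O) := linfun (a \*o D).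

Lemma lmulDE a D b : lmulD a D b = a * D b.
Proof. by rewrite lfunE. Qed.

Definition frakD : 'End(O) :=
  \sum_(s : 'I_n + 'I_n) lmulD (xvar (var2 s)) (dvar (var2 s)).

Definition Delta_ (i : 'I_n) : 'End(O) :=
  (dvar (var2 (inl i)) \o dvar (var2 (prime_ (inl i))))%VF.

Definition Delta : 'End(O) := \sum_(i < n) Delta_ i.

(* The formulas for T_H, D_KO and div_lam with p(a) replaced by e; they apply
   to a of parity e and extend linearly to all a. *)
Definition TH_hom (e : bool) a : 'End(O) :=
  \sum_(s : 'I_n + 'I_n) (-1) ^+ (mu (var2 (prime_ s)) * e)
     *: lmulD (dvar (var2 (prime_ s)) a) (dvar (var2 s)).

Definition DKO_hom (e : bool) a : 'End(O) :=
  TH_hom e a + (-1) ^+ e *: lmulD (dvar vlast a) frakD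
  + lmulD (frakD a - 2%:R *: a) (dvar vlast).

Definition DKO a : 'End(O) := \sum_(e : bool) DKO_hom e (par e a).

Definition divl_hom (lam : F) (e : bool) a : O :=
  (-1) ^+ e *: (2%:R *:
    (Delta a + (frakD - (n%:R * lam) *: \1%VF) (dvar vlast a))).

Definition divl (lam : F) a : O := \sum_(e : bool) divl_hom lam e (par e a).

Definition SKO2 (lam : F) (D : 'End(O)) : Prop :=
  exists2 a, divl lam a = 0 & D = DKO a.

Definition nabla_basis (i : 'I_n) (k : bidx p t) : O :=
  mono (fun l => k.1 l + (l == i))%N set0
    * (xvar (var2 (prime_ (inl i))) * mono (fun=> 0%N) k.2).

Definition nabla (i : 'I_n) : 'End(O) := linfun (lext (nabla_basis i)).

Definition Gamma_ (i j : 'I_n) : 'End(O) := (nabla j \o Delta_ i)%VF.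

(* The monomials x^(al) x^u in which x_(2n+1) does not occur; i \in u stands
   for the occurrence of x_(i'). *)
Section Monomials.
Variables (al : expo p t) (us : {set 'I_n}).

Definition xmono : O := mono (fun i => al i : nat) (wid @: us).

Definition zd : nat := (\sum_(i < n) al i + #|us|)%N.

Definition Iset : {set 'I_n} := [set i | Delta_ i xmono != 0].

Definition Itilde : {set 'I_n} := [set i | nabla i xmono != 0].

Definition Dstar : bool := (Iset != set0) && (Itilde != set0).

Definition is_qmin (q : 'I_n) : Prop :=
  q \in Itilde /\ forall i, i \in Itilde -> (q <= i)%N.

Definition Aelt (q : 'I_n) : O := xmono - \sum_(i in Iset) Gamma_ i q xmono.

Definition Belt (lam : F) (q : 'I_n) : O :=
  ((-1) ^+ #|us| * (n%:R * lam - zd%:R)) *: nabla q xmono.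

End Monomials.

Definition expo0 : expo p t := [ffun=> ord0].

Definition S1 (D : 'End(O)) : Prop := exists (al : expo p t) (us : {set 'I_n}),
  [/\ Iset al us = set0, (al, us) <> (expo0, set0) & D = DKO (xmono al us)].

Definition S2 (D : 'End(O)) : Prop :=
  exists (al : expo p t) (us : {set 'I_n}) (q : 'I_n),
  [/\ Dstar al us, q \in Itilde al us & D = DKO (Aelt al us q)].

Definition S3 (lam : F) (D : 'End(O)) : Prop :=
  exists (al : expo p t) (us : {set 'I_n}) (q : 'I_n),
  [/\ Iset al us = set0, Itilde al us != set0, is_qmin al us q
    & D = DKO (xmono al us * xvar vlast + Belt al us lam q)].

Definition S4 (lam : F) (D : 'End(O)) : Prop :=
  exists (al : expo p t) (us : {set 'I_n}) (q : 'I_n),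
  [/\ Dstar al us, q \in Itilde al us
    & D = DKO (Aelt al us q * xvar vlast + Belt al us lam q)].

Definition S5 (lam : F) (D : 'End(O)) : Prop :=
  exists (al : expo p t) (us : {set 'I_n}),
  [/\ Iset al us = set0, Itilde al us = set0, n%:R * lam - (zd al us)%:R = 0
    & D = DKO (xmono al us * xvar vlast)].

End SuperAlgebra.

Definition in_span (F : fieldType) (V : vectType F) (S : V -> Prop) (v : V) :
    Prop :=
  exists2 X : seq V, (forall w, w \in X -> S w) & v \in <<X>>%VS.

(* Main.v *)
From HB Require Import structures.
Require Import Defs.
From mathcomp Require Import all_boot all_order all_algebra.
From mathcomp Require Import ring zify.

(* div_lam a = 0 means Delta a + T a = 0, with T = (D - n lam) d_(2n+1).  At each
   site i, a monomial is either killed by both Delta_i and nabla_i, or live, and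
   then these two operators exchange it with a partner.  With c = nabla_q, where
   q is the least live site of a monomial, Delta c + c Delta = 1 - P; here P
   projects on the monomials without live sites, and P Delta = 0.  Hence
   Delta a = - T a gives a = P a + (Delta c - c T) a.  On monomials with live
   sites, Delta c - c T takes the values 0, A and A x_(2n+1) + B (with
   A = x^(al) x^u if I is empty), since Delta nabla_q m = m - nabla_q Delta m = A
   for q in Itilde; and T (P a) = 0 restricts the monomials of P a to those of
   S1, S5 and 1. *)

Set Implicit Arguments.
Unset Strict Implicit.
Unset Printing Implicit Defensive.
Import GRing.Theory.
Local Open Scope ring_scope.

(** * Closure properties of spans of predicates *)

Section InSpan.
Variables (F : fieldType) (V : vectType F) (S : V -> Prop).

Lemma in_span0 : in_span S 0.
Proof. by exists [::] => //; rewrite mem0v. Qed.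

Lemma in_spanZ x v : in_span S v -> in_span S (x *: v).
Proof. by case=> s hs vs; exists s; rewrite ?memvZ. Qed.

Lemma in_spanD v w : in_span S v -> in_span S w -> in_span S (v + w).
Proof.
case=> s hs vs [r hr wr]; exists (s ++ r); last by rewrite span_cat memv_add.
by move=> y; rewrite mem_cat => /orP[/hs|/hr].
Qed.

Lemma mem_in_span v : S v -> in_span S v.
Proof.
by move=> Sv; exists [:: v]; [move=> w; rewrite inE => /eqP -> | rewrite memv_span1].
Qed.

Lemma in_span_sum (I : finType) (f : I -> V) :
  (forall i, in_span S (f i)) -> in_span S (\sum_i f i).
Proof.
by move=> h; apply: big_ind => //; [exact: in_span0 | exact: in_spanD].
Qed.

Lemma in_span_sub (U : {vspace V}) v :
  (forall w, S w -> w \in U) -> in_span S v -> v \in U.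
Proof.
move=> h [s hs]; apply: subvP; apply/span_subvP => w /hs; exact: h.
Qed.

End InSpan.

Lemma wid_inj n : injective (@wid n).
Proof. by move=> i j /(congr1 val) /= e; apply: val_inj. Qed.

Lemma wid_neq_max n (i : 'I_n) : wid i != ord_max.
Proof. by rewrite -val_eqE /= neq_ltn ltn_ord. Qed.

Lemma mem_imset_wid n (us : {set 'I_n}) i : (wid i \in [set wid x | x in us]) = (i \in us).
Proof. exact/mem_imset/wid_inj. Qed.

(** * Anticommutation of the operators Delta_i and nabla_j on monomials *)

Section Relations.
Variables (F : fieldType) (p n : nat) (t : 'I_n -> nat).
Local Notation O := (superO F p t).
Local Notation X := (@mono F p n t).
Local Notation pii := (pi_ p t).
Local Notation dl := (Delta_ F p t).
Local Notation nb := (nabla F p t).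
Local Notation dlast := (dvar F p t (vlast n)).
Local Notation xlast := (xvar F p t (vlast n)).
Implicit Types (a b : O) (al be : 'I_n -> nat) (u : {set 'I_n.+1}) (i j q : 'I_n).

(** Operator identities need testing only on the basis. The bound on exponents matters: when al i =
    pi_i + 1 the monomial is 0, but the formula for its i-th derivative need not give 0. *)
Lemma mono_lin_ext (f g : O -> O) : linear f -> linear g ->
  (forall al u, (forall i, (al i <= pii i)%N) -> f (X al u) = g (X al u)) -> f =1 g.
Proof.
move=> lf lg fg a.
pose f' : {linear O -> O} := HB.pack f (GRing.isLinear.Build F O O _ f lf).
pose g' : {linear O -> O} := HB.pack g (GRing.isLinear.Build F O O _ g lg).
rewrite -[f a]/(f' a) -[g a]/(g' a) -[a]lext_bmono /lext !linear_sum.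
apply: eq_bigr => k _; rewrite !linearZ; congr (_ *: _).
by apply: fg => i; rewrite -ltnS ltn_ord.
Qed.

(** The sign of moving x_y to the front of x^u, whether x_y is taken out of x^u or inserted into
    it. *)
Definition osign u (y : 'I_n.+1) : F := (-1) ^+ #|[set l in u | (l < y)%N]|.

Lemma osignM u (y : 'I_n.+1) : osign u y * osign u y = 1.
Proof. by rewrite /osign -expr2 sqrr_sign. Qed.

Lemma osignU1 u (x j : 'I_n.+1) : x \notin u ->
  osign (x |: u) j = (-1) ^+ (x < j)%N * osign u j.
Proof.
move=> xu; rewrite /osign -exprD; congr (_ ^+ _).
have -> : [set l in x |: u | (l < j)%N] =
    (if (x < j)%N then [set x] else set0) :|: [set l in u | (l < j)%N].
  by apply/setP => l; case: ifP => h; rewrite !inE;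
     case: eqP => //= ->; rewrite ?h ?(negbTE xu).
case: ifP => _; last by rewrite set0U.
by rewrite cardsU1 inE (negbTE xu).
Qed.

Lemma osignD1 u (x j : 'I_n.+1) : x \in u ->
  osign (u :\ x) j = (-1) ^+ (x < j)%N * osign u j.
Proof.
move=> xu; rewrite -[in RHS](setD1K xu) osignU1 ?inE ?eqxx //.
by rewrite mulrA -expr2 sqrr_sign mul1r.
Qed.

Lemma Delta_mono i al u : (al i <= pii i)%N -> dl i (X al u) =
  if (wid i \in u) && (al i != 0)%N
  then osign u (wid i) *: X (fun l => al l - (l == i))%N (u :\ wid i) else 0.
Proof.
move=> hi; rewrite /Delta_ comp_lfunE dvar_odd.
case: ifP => _ /=; last by rewrite linear0.
by rewrite linearZ /= dvar_even //; case: eqP => _; rewrite ?scaler0.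
Qed.

Lemma xvar_mono (j : 'I_n.+1) u : xvar F p t (inr j) * X (fun=> 0%N) u =
  if j \in u then 0 else osign u j *: X (fun=> 0%N) (j |: u).
Proof.
rewrite monoM /mono_coef disjoints1; case: (boolP (j \in u)) => _ /=; first by rewrite scale0r.
by rewrite inver1l big1 ?mulr1 // => i _; rewrite bin0.
Qed.

(** [nabla] shifts the exponent instead of multiplying by x_i, so the binomial coefficients are all
    C(k, 0) or C(k, k). Hence nabla_i undoes Delta_i without a scalar factor other than a sign. *)
Lemma nabla_mono i al u : nb i (X al u) =
  if wid i \in u then 0
  else osign u (wid i) *: X (fun l => al l + (l == i))%N (wid i |: u).
Proof.
have E k : nabla_basis F i k = if wid i \in k.2 then 0
    else osign k.2 (wid i) *: X (fun l => k.1 l + (l == i))%N (wid i |: k.2).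
  rewrite /nabla_basis xvar_mono; case: ifP => _; first by rewrite mulr0.
  rewrite -scalerAr monoM set0U /mono_coef /inver big_set0 -setI_eq0 set0I eqxx.
  rewrite big1 ?mulr1 ?scale1r => [|l _]; last by rewrite addn0 binn.
  by congr (_ *: _); apply: eq_mono => l; rewrite addn0.
rewrite lfunE /=.
case: (mono_case F p t al u) => [[k -> [<- ek]] | [-> [j hj]]].
  rewrite lextE E; case: ifP => // _; congr (_ *: _).
  by apply: eq_mono => l; rewrite ek.
rewrite linear0 (mono_oob F _ (i := j)) ?scaler0 ?if_same //.
exact: leq_trans hj (leq_addr _ _).
Qed.

(* The states of a site i come in pairs (c, without x_i'), (c + 1, with x_i');
   only (0, with x_i') and (pi_i, without x_i') stay unpaired. *)
Definition live al u i : bool :=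
  if wid i \in u then (0 < al i)%N else (al i < pii i)%N.

(** In each state of site i at most one of the two products survives. It goes to the partner state
    and back, and the same sign occurs twice, so it cancels. *)
Lemma Delta_nabla_diag i al u : (al i <= pii i)%N ->
  dl i (nb i (X al u)) + nb i (dl i (X al u)) = (live al u i)%:R *: X al u.
Proof.
move=> hi; rewrite nabla_mono Delta_mono // /live lt0n.
case: (boolP (wid i \in u)) => iu /=.
  rewrite linear0 add0r; case: (eqVneq (al i) 0%N) => [|ai] /=.
    by rewrite linear0 scale0r.
  rewrite linearZ /= nabla_mono !inE eqxx /= osignD1 // ltnn mul1r scalerA.
  rewrite osignM !scale1r setD1K //; apply: eq_mono => l.
  by case: (eqVneq l i) => [->|_]; rewrite ?subn0 ?addn0 // subnK // lt0n.
rewrite linear0 addr0 linearZ /=.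
case: (ltnP (al i) (pii i)) => h /=; last first.
  by rewrite (mono_oob F _ (i := i)) ?linear0 ?scaler0 ?scale0r // eqxx addn1.
rewrite Delta_mono ?eqxx ?addn1 // setU11 /= osignU1 // ltnn mul1r scalerA.
rewrite osignM !scale1r setU1K //; apply: eq_mono => l.
by rewrite addnK.
Qed.

Lemma sign_anticomm (j i : 'I_n) : i != j ->
  (-1) ^+ (wid j < wid i)%N = - (-1) ^+ (wid i < wid j)%N :> F.
Proof.
move=> ij; rewrite /=; case: (ltngtP j i) => h //=.
- by rewrite expr0 expr1 opprK.
- by move: ij; rewrite -val_eqE /= h eqxx.
Qed.

(** At distinct sites the exponents change independently. The minus sign comes from the two odd
    variables, since exactly one of them precedes the other. *)
Lemma Delta_nabla_off i j a : i != j -> dl i (nb j a) = - nb j (dl i a).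
Proof.
move=> ij; move: a; apply: mono_lin_ext => [x a b|x a b|al u hal].
- by rewrite !linearP.
- by rewrite !linearP.
have wij : (wid i == wid j) = false by rewrite (inj_eq (@wid_inj n)) (negbTE ij).
have wji : (wid j == wid i) = false by rewrite eq_sym.
rewrite nabla_mono Delta_mono //.
case: (boolP (wid j \in u)) => ju.
  rewrite linear0; case: ifP => _; last by rewrite !linear0.
  by rewrite linearZ /= nabla_mono !inE wji /= ju !linear0.
rewrite linearZ /= Delta_mono; last by rewrite (negbTE ij) addn0.
rewrite !inE wij /= (negbTE ij) addn0.
case: ifP => [/andP[iu ai]|_]; last by rewrite !linear0.
rewrite [nb j _]linearZ /= nabla_mono !inE wji (negbTE ju) /= !scalerA -scaleNr.
rewrite osignU1 // osignD1 // (sign_anticomm ij).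
rewrite (_ : (_ |: _) :\ _ = wid j |: u :\ wid i); last first.
  by apply/setP => l; rewrite !inE; case: (eqVneq l (wid j)) => [->|]; rewrite ?wji ?andbF.
congr (_ *: _); first by ring.
apply: eq_mono => l; case: (eqVneq l i) => [->|_]; rewrite ?subn0 //.
by rewrite (negbTE ij) !addn0.
Qed.

Lemma Delta_anticomm i j a : dl i (dl j a) = - dl j (dl i a).
Proof.
move: a; apply: mono_lin_ext => [x a b|x a b|al u hal].
- by rewrite !linearP.
- by rewrite !linearP.
case: (eqVneq i j) => [->|ij].
  rewrite (_ : dl j (dl j _) = 0) ?oppr0 //.
  rewrite Delta_mono //; case: ifP => // _; last by rewrite linear0.
  rewrite linearZ /= Delta_mono ?eqxx ?inE ?eqxx ?scaler0 //.
  exact: leq_trans (leq_subr _ _) (hal j).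
have wij : (wid i == wid j) = false by rewrite (inj_eq (@wid_inj n)) (negbTE ij).
have wji : (wid j == wid i) = false by rewrite eq_sym.
have ji : (j == i) = false by rewrite eq_sym (negbTE ij).
rewrite !Delta_mono //.
case: (boolP ((wid j \in u) && _)) => [/andP[ju aj]|hj]; last first.
  rewrite linear0; case: ifP => _; last by rewrite !linear0.
  rewrite [dl j _]linearZ /= Delta_mono ?ji ?subn0 // !inE wji /=.
  by rewrite (negbTE hj) !linear0.
rewrite linearZ /= Delta_mono ?(negbTE ij) ?subn0 // !inE wij /=.
case: ifP => [/andP[iu ai]|_]; last by rewrite !linear0.
rewrite [dl j _]linearZ /= Delta_mono ?ji ?subn0 // !inE wji ju aj /= !scalerA -scaleNr.
rewrite !osignD1 // (sign_anticomm ij) setDDl setUC -setDDl.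
congr (_ *: _); first by ring.
by apply: eq_mono => l; rewrite subnAC.
Qed.

Lemma Delta_sum a : Delta F p t a = \sum_i dl i a.
Proof. by rewrite /Delta sum_lfunE. Qed.

Lemma Delta_Delta a : (2%:R : F) != 0 -> Delta F p t (Delta F p t a) = 0.
Proof.
move=> two; have E : Delta F p t (Delta F p t a) = \sum_i \sum_j dl i (dl j a).
  by rewrite Delta_sum; apply: eq_bigr => i _; rewrite Delta_sum linear_sum.
(* Exchanging i and j turns the double sum into its own negative. *)
have : Delta F p t (Delta F p t a) = - Delta F p t (Delta F p t a).
  rewrite {1}E exchange_big E -sumrN; apply: eq_bigr => i _.
  by rewrite -sumrN; apply: eq_bigr => j _; rewrite Delta_anticomm.
move/eqP; rewrite -addr_eq0 -mulr2n -scaler_nat scaler_eq0 (negbTE two) /=.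
by move/eqP.
Qed.

(** Only the diagonal term i = q survives in the sum of the anticommutators. *)
Lemma Delta_nabla q al u : (forall i, (al i <= pii i)%N) ->
  Delta F p t (nb q (X al u)) + nb q (Delta F p t (X al u)) =
  (live al u q)%:R *: X al u.
Proof.
move=> hal; rewrite !Delta_sum linear_sum -big_split /= (bigD1 q) //=.
rewrite Delta_nabla_diag // big1 ?addr0 // => i iq.
by rewrite Delta_nabla_off // addNr.
Qed.

(** * The contracting homotopy for Delta *)

Definition site al u : option 'I_n :=
  [pick q | live al u q && [forall i, live al u i ==> (q <= i)%N]].

Lemma eq_site al be u v : live al u =1 live be v -> site al u = site be v.
Proof.
move=> e; apply: eq_pick => q; rewrite e; congr (_ && _).
by apply: eq_forallb => i; rewrite e.
Qed.

Lemma eq_live al be u : al =1 be -> live al u =1 live be u.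
Proof. by move=> e i; rewrite /live e. Qed.

Lemma site_some al u q : site al u = Some q ->
  live al u q /\ forall i, live al u i -> (q <= i)%N.
Proof.
rewrite /site; case: pickP => // x /andP[lx /forallP h] [<-]; split=> // i li.
exact: (implyP (h i)).
Qed.

Lemma site_none al u i : site al u = None -> live al u i = false.
Proof.
rewrite /site; case: pickP => // h _; apply/negP => li.
have := h [arg min_(x < i | live al u x) (x : nat)].
case: arg_minnP => // x lx hx /negP[]; rewrite lx /=.
by apply/forallP => y; apply/implyP/hx.
Qed.

(** Delta_i moves site i to its partner state, which is live again, and leaves the other sites
    alone. So [site] picks the same q for a monomial and for all terms of its image under Delta. The
    least element of [Itilde] would not be stable in this way, because Delta_i adds i to
    [Itilde]. *)
Lemma live_Delta i j al u : (al i <= pii i)%N -> wid i \in u -> al i != 0%N ->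
  live (fun l => al l - (l == i))%N (u :\ wid i) j = live al u j.
Proof.
move=> hi iu ai; rewrite /live !inE (inj_eq (@wid_inj n)).
case: (eqVneq j i) => [->|_] /=; last by rewrite subn0.
by rewrite iu /= subn1 lt0n ai prednK // lt0n.
Qed.

Definition contraction_basis (k : bidx p t) : O :=
  if site (fun i => k.1 i : nat) k.2 is Some q then nb q (bmono F k) else 0.

Definition contraction : 'End(O) := linfun (lext contraction_basis).

Lemma contraction_mono al u :
  contraction (X al u) = if site al u is Some q then nb q (X al u) else 0.
Proof.
rewrite lfunE /=.
case: (mono_case F p t al u) => [[k -> [<- ek]] | [-> _]].
  by rewrite lextE /contraction_basis (eq_site (eq_live _ ek)).
by rewrite linear0; case: (site al u) => // q; rewrite linear0.
Qed.

Definition dead_basis (k : bidx p t) : O :=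
  if site (fun i => k.1 i : nat) k.2 is Some q then 0 else bmono F k.

Definition dead : 'End(O) := linfun (lext dead_basis).

Lemma dead_mono al u :
  dead (X al u) = if site al u is Some q then 0 else X al u.
Proof.
rewrite lfunE /=.
case: (mono_case F p t al u) => [[k -> [<- ek]] | [-> _]].
  by rewrite lextE /dead_basis (eq_site (eq_live _ ek)).
by rewrite linear0; case: (site al u).
Qed.

(** A nonzero term Delta_i m still has i as a live site, so the projection kills it. *)
Lemma dead_Delta a : dead (Delta F p t a) = 0.
Proof.
move: a; apply: (@mono_lin_ext _ (fun=> 0)) => [x a b|x a b|al u hal].
- by rewrite !linearP.
- by rewrite scaler0 addr0.
rewrite Delta_sum linear_sum big1 // => i _.
rewrite Delta_mono //; case: ifP => [/andP[iu ai]|_]; last by rewrite linear0.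
rewrite linearZ /= dead_mono; case E: (site _ _) => [q|]; first by rewrite scaler0.
have := site_none i E; rewrite (live_Delta _ (hal i) iu ai) /live iu.
by rewrite lt0n ai.
Qed.

(** Since Delta preserves [site], the contraction acts on m and on Delta m by the same nabla_q, and
    [Delta_nabla] applies. Without live sites both products vanish. *)
Lemma homotopy a :
  Delta F p t (contraction a) + contraction (Delta F p t a) = a - dead a.
Proof.
move: a; apply: mono_lin_ext => [x a b|x a b|al u hal].
- by rewrite !linearD !linearZ /= addrACA.
- by rewrite !linearD !linearZ /= addrACA.
have hD i : contraction (dl i (X al u)) =
    if site al u is Some q then nb q (dl i (X al u)) else 0.
  rewrite Delta_mono //; case: ifP => [/andP[iu ai]|_]; last first.
    by rewrite linear0; case: site => // q; rewrite linear0.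
  rewrite linearZ /= contraction_mono.
  rewrite (eq_site (fun j => live_Delta j (hal i) iu ai)).
  by case: site => [q|]; rewrite ?linearZ ?scaler0.
rewrite contraction_mono dead_mono (Delta_sum (X al u)) linear_sum (eq_bigr _ (fun i _ => hD i)).
case E: (site al u) => [q|]; last by rewrite linear0 big1 // addr0 subrr.
rewrite -linear_sum -Delta_sum Delta_nabla // subr0.
by have [-> _] := site_some E; rewrite scale1r.
Qed.

(* The degree zd, but for exponents and odd parts that are not of the form
   (al, wid @: us); x_(2n+1) is not counted. *)
Definition mdeg al u : nat := (\sum_i al i + \sum_i (wid i \in u))%N.

(** * The degree derivation *)

Lemma frakD_mono al u : (forall i, (al i <= pii i)%N) ->
  frakD F p t (X al u) = (mdeg al u)%:R *: X al u.
Proof.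
move=> hal; rewrite /frakD sum_lfunE big_sumType /= natrD scalerDl.
rewrite !natr_sum !scaler_suml; congr (_ + _); apply: eq_bigr => i _.
  rewrite lmulDE /= dvar_even //; case: eqP => [->|/eqP ai].
    by rewrite mulr0 scale0r.
  (* The divided power product of x_i and x^(al - e_i) is C(al_i, 1) x^(al), which gives the factor
     al_i. *)
  rewrite monoM /mono_coef -setI_eq0 set0I eqxx /inver big_set0 expr0 mul1r set0U.
  rewrite (bigD1 i) //= big1 => [|l li]; last by rewrite (negbTE li) bin0.
  have ai1 : (1 + (al i - 1) = al i)%N by rewrite subnKC // lt0n.
  rewrite eqxx muln1 ai1 bin1; congr (_ *: _); apply: eq_mono => l.
  by case: (eqVneq l i) => [->|_]; rewrite ?ai1 ?subn0.
rewrite lmulDE /= dvar_odd; case: ifP => iu; last by rewrite mulr0 scale0r.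
rewrite -scalerAr monoM /mono_coef disjoints1 !inE eqxx /= inver1l.
rewrite big1 => [|l _]; last by rewrite bin0.
rewrite mulr1 scalerA setD1K //.
rewrite (_ : [set l in u :\ wid i | (l < wid i)%N] =
             [set l in u | (l < wid i)%N]); last first.
  by apply/setP => l; rewrite !inE; case: eqP => // ->; rewrite ltnn !andbF.
by rewrite -expr2 sqrr_sign.
Qed.

(** One even and one odd factor disappear, so the degree drops by 2. *)
Lemma frakD_Delta i a :
  frakD F p t (dl i a) = dl i (frakD F p t a) - 2%:R *: dl i a.
Proof.
move: a; apply: mono_lin_ext => [x a b|x a b|al u hal].
- by rewrite !linearD !linearZ.
- by rewrite !linearD !linearZ /= addrACA.
rewrite frakD_mono // linearZ /= Delta_mono //.
case: ifP => [/andP[iu ai]|_]; last by rewrite !linear0 addr0.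
rewrite linearZ /= frakD_mono; last first.
  by move=> l; exact: leq_trans (leq_subr _ _) (hal l).
rewrite -scalerBl !scalerA; congr (_ *: _); rewrite mulrC; congr (_ * _).
apply/eqP; rewrite eq_sym subr_eq -natrD; apply/eqP; congr _%:R.
rewrite /mdeg (bigD1 i) //= [in RHS](bigD1 i) //=.
rewrite (bigD1 i (F := fun l => (wid l \in u) : nat)) //=.
rewrite (bigD1 i (F := fun l => (wid l \in u :\ wid i) : nat)) //=.
rewrite iu !inE eqxx /=.
have -> : (\sum_(l | l != i) (wid l \in u :\ wid i) =
           \sum_(l | l != i) (wid l \in u))%N.
  by apply: eq_bigr => l li; rewrite !inE (inj_eq (@wid_inj n)) li.
have -> : (\sum_(l < n | l != i) (al l - (l == i)) =
           \sum_(l < n | l != i) al l)%N.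
  by apply: eq_bigr => l /negbTE ->; rewrite subn0.
move: ai; rewrite eqxx -lt0n /=.
move: (\sum_(l < n | l != i) al l)%N (\sum_(l | l != i) (wid l \in u))%N => A B.
lia.
Qed.

Lemma frakD_nabla i a :
  frakD F p t (nb i a) = nb i (frakD F p t a) + 2%:R *: nb i a.
Proof.
move: a; apply: mono_lin_ext => [x a b|x a b|al u hal].
- by rewrite !linearD !linearZ.
- by rewrite !linearD !linearZ /= addrACA !scalerA [2%:R * x]mulrC.
rewrite frakD_mono // linearZ /= nabla_mono.
case: (boolP (wid i \in u)) => iu; first by rewrite !linear0 addr0.
rewrite linearZ /=; case: (ltnP (al i) (pii i)) => h; last first.
  rewrite (mono_oob F _ (i := i)) ?eqxx ?addn1 // !linear0 ?scaler0 ?addr0 //.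
rewrite frakD_mono; last first.
  by move=> l; case: (eqVneq l i) => [->|_]; rewrite ?addn1 ?addn0.
rewrite -scalerDl !scalerA; congr (_ *: _); rewrite mulrC; congr (_ * _).
rewrite -natrD; congr _%:R.
rewrite /mdeg (bigD1 i) //= [in RHS](bigD1 i) //=.
rewrite (bigD1 i (F := fun l => (wid l \in u) : nat)) //=.
rewrite (bigD1 i (F := fun l => (wid l \in wid i |: u) : nat)) //=.
rewrite (negbTE iu) !inE eqxx /=.
have -> : (\sum_(l | l != i) (wid l \in wid i |: u) =
           \sum_(l | l != i) (wid l \in u))%N.
  by apply: eq_bigr => l li; rewrite !inE (inj_eq (@wid_inj n)) (negbTE li).
have -> : (\sum_(l < n | l != i) (al l + (l == i)) =
           \sum_(l < n | l != i) al l)%N.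
  by apply: eq_bigr => l /negbTE ->; rewrite addn0.
rewrite ?eqxx /=.
move: (\sum_(l < n | l != i) al l)%N (\sum_(l | l != i) (wid l \in u))%N => A B.
lia.
Qed.

(** * The odd variable x_(2n+1) *)

Lemma dlast_mono al u : dlast (X al u) =
  if ord_max \in u then osign u ord_max *: X al (u :\ ord_max) else 0.
Proof. exact: dvar_odd. Qed.

Lemma max_wid i : (ord_max == wid i :> 'I_n.+1) = false.
Proof. by rewrite eq_sym (negbTE (wid_neq_max i)). Qed.

(** Removing x_i', which stands in front of x_(2n+1), changes the sign of removing x_(2n+1). *)
Lemma dlast_Delta i a : dlast (dl i a) = - dl i (dlast a).
Proof.
move: a; apply: mono_lin_ext => [x a b|x a b|al u hal].
- by rewrite !linearD !linearZ.
- by rewrite !linearD !linearZ /=.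
rewrite dlast_mono Delta_mono //.
have mi := wid_neq_max i; have im := max_wid i.
case: (boolP (ord_max \in u)) => mu; last first.
  rewrite linear0 oppr0; case: ifP => _; last by rewrite linear0.
  by rewrite linearZ /= dlast_mono !inE im (negbTE mu) scaler0.
rewrite [dl i _]linearZ /= Delta_mono // !inE mi /=.
case: ifP => [/andP[iu ai]|_]; last by rewrite !linear0.
rewrite linearZ /= dlast_mono !inE im mu /= !scalerA -scaleNr.
rewrite !osignD1 // setDDl setUC -setDDl; congr (_ *: _).
have -> : (wid i < @ord_max n)%N = true by rewrite /= ltn_ord.
have -> : (@ord_max n < wid i)%N = false by rewrite ltnNge ltnW //= ltn_ord.
by rewrite expr0 expr1; ring.
Qed.

Lemma dlast_nabla i a : dlast (nb i a) = - nb i (dlast a).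
Proof.
move: a; apply: mono_lin_ext => [x a b|x a b|al u hal].
- by rewrite !linearD !linearZ.
- by rewrite !linearD !linearZ /=.
rewrite dlast_mono nabla_mono.
have mi := wid_neq_max i; have im := max_wid i.
case: (boolP (ord_max \in u)) => mu; last first.
  rewrite linear0 oppr0; case: ifP => _; first by rewrite linear0.
  by rewrite linearZ /= dlast_mono !inE im (negbTE mu) scaler0.
rewrite [nb i _]linearZ /= nabla_mono !inE mi /=.
case: (boolP (wid i \in u)) => iu; first by rewrite !linear0.
rewrite linearZ /= dlast_mono !inE mu orbT /= !scalerA -scaleNr.
rewrite osignU1 // osignD1 //.
rewrite (_ : (_ |: _) :\ _ = wid i |: u :\ ord_max); last first.
  by apply/setP => l; rewrite !inE; case: (eqVneq l (wid i)) => [->|]; rewrite ?mi ?andbF.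
congr (_ *: _).
have -> : (wid i < @ord_max n)%N = true by rewrite /= ltn_ord.
have -> : (@ord_max n < wid i)%N = false by rewrite ltnNge ltnW //= ltn_ord.
by rewrite expr0 expr1; ring.
Qed.

Lemma mono_xlast al u : X al u * xlast =
  if ord_max \in u then 0 else X al (ord_max |: u).
Proof.
rewrite /= monoM /mono_coef disjoint_sym disjoints1; case: (boolP (_ \in u)) => mu /=.
  by rewrite scale0r.
rewrite inver1r (_ : [set l in u | _] = set0); last first.
  by apply/setP => l; rewrite !inE [(_ < l)%N]ltnNge -ltnS ltn_ord andbF.
rewrite cards0 expr0 big1 ?mulr1 ?scale1r => [|l _]; last by rewrite addn0 binn.
by rewrite setUC; apply: eq_mono => l; rewrite addn0.
Qed.

(** No sign appears: x_(2n+1) is the last odd variable and is multiplied on the right, while the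
    signs count variables to the left. *)
Lemma Delta_xlast i a : dl i (a * xlast) = dl i a * xlast.
Proof.
move: a; apply: mono_lin_ext => [x a b|x a b|al u hal].
- by rewrite mulrDl -scalerAl !linearD !linearZ.
- by rewrite !linearD !linearZ /= mulrDl -scalerAl.
have mi := wid_neq_max i; have im := max_wid i.
rewrite mono_xlast Delta_mono //; case: (boolP (ord_max \in u)) => mu.
  rewrite linear0; case: ifP => _; last by rewrite mul0r.
  by rewrite -scalerAl mono_xlast !inE im mu scaler0.
rewrite Delta_mono // !inE (negbTE mi) /=.
case: ifP => [/andP[iu ai]|_]; last by rewrite mul0r.
rewrite -scalerAl mono_xlast !inE (negbTE mu) andbF osignU1 //.
have -> : (@ord_max n < wid i)%N = false by rewrite ltnNge ltnW //= ltn_ord.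
rewrite mul1r; congr (_ *: X _ _).
by apply/setP => l; rewrite !inE; case: (eqVneq l ord_max) => [->|]; rewrite ?im.
Qed.

Lemma nabla_xlast i a : nb i (a * xlast) = nb i a * xlast.
Proof.
move: a; apply: mono_lin_ext => [x a b|x a b|al u hal].
- by rewrite mulrDl -scalerAl !linearD !linearZ.
- by rewrite !linearD !linearZ /= mulrDl -scalerAl.
have mi := wid_neq_max i; have im := max_wid i.
rewrite mono_xlast nabla_mono; case: (boolP (ord_max \in u)) => mu.
  rewrite linear0; case: ifP => _; first by rewrite mul0r.
  by rewrite -scalerAl mono_xlast !inE mu orbT scaler0.
rewrite nabla_mono !inE (negbTE mi) /=.
case: (boolP (wid i \in u)) => iu; first by rewrite mul0r.
rewrite -scalerAl mono_xlast !inE im (negbTE mu) /= osignU1 //.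
have -> : (@ord_max n < wid i)%N = false by rewrite ltnNge ltnW //= ltn_ord.
by rewrite mul1r setUCA.
Qed.

(** * The divergence freed of its parity signs *)

Definition Tlast (lam : F) : 'End(O) :=
  ((frakD F p t - (n%:R * lam) *: \1) \o dlast)%VF.

Lemma TlastE lam a :
  Tlast lam a = frakD F p t (dlast a) - (n%:R * lam) *: dlast a.
Proof. by rewrite comp_lfunE add_lfunE opp_lfunE scale_lfunE id_lfunE. Qed.

(* div_lam up to the factor 2 and the signs (-1)^p(a). *)
Definition rdiv lam : 'End(O) := (Delta F p t + Tlast lam)%VF.

Lemma rdivE lam a : rdiv lam a = Delta F p t a + Tlast lam a.
Proof. exact: add_lfunE. Qed.

Lemma par_linear e : linear (@par F p n t e).
Proof.
move=> x a b; apply/ffunP => k; rewrite !ffunE; case: ifP => // _.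
by rewrite scaler0 addr0.
Qed.

(** The parity involution, which sends a homogeneous a to (-1)^p(a) a. It absorbs the sign in
    div_lam. *)
Definition grading : 'End(O) := linfun (lext (fun k => (-1) ^+ #|k.2| *: bmono F k)).

Lemma grading_mono al u : grading (X al u) = (-1) ^+ #|u| *: X al u.
Proof.
rewrite lfunE /=.
case: (mono_case F p t al u) => [[k -> [<- ek]] | [-> _]].
  by rewrite lextE.
by rewrite !linear0.
Qed.

Lemma grading_par a : grading a = par false a - par true a.
Proof.
move: a; apply: mono_lin_ext => [x a b|x a b|al u hal].
- by rewrite !linearD !linearZ.
- by rewrite !par_linear scalerBr opprD addrACA.
rewrite grading_mono -signr_odd; apply/ffunP => k; rewrite !ffunE.
case: eqP => [-> | _]; last by rewrite andbF !if_same subr0 scaler0.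
by case: (odd _); rewrite /= ?subr0 ?sub0r ?scaleN1r ?scale1r.
Qed.

Lemma gradingK a : grading (grading a) = a.
Proof.
move: a; apply: mono_lin_ext => [x a b|//|al u hal].
- by rewrite !linearD !linearZ.
by rewrite grading_mono linearZ /= grading_mono scalerA -expr2 sqrr_sign scale1r.
Qed.

Lemma divlE lam a : divl lam a = 2%:R *: rdiv lam (grading a).
Proof.
rewrite /divl big_bool /= /divl_hom expr0 expr1 scale1r scaleN1r.
have E b : Delta F p t b + (frakD F p t - (n%:R * lam) *: \1%VF) (dlast b) = rdiv lam b.
  by rewrite rdivE comp_lfunE.
rewrite !E grading_par addrC -scalerBr; congr (_ *: _).
by rewrite linearB.
Qed.

Lemma grading_Delta a : grading (Delta F p t a) = - Delta F p t (grading a).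
Proof.
rewrite !Delta_sum linear_sum -sumrN; apply: eq_bigr => i _.
move: a; apply: mono_lin_ext => [x a b|x a b|al u hal].
- by rewrite !linearD !linearZ.
- by rewrite !linearD !linearZ.
rewrite grading_mono [dl i (_ *: _)]linearZ /= Delta_mono //.
case: ifP => [/andP[iu _]|_]; last by rewrite !linear0.
rewrite linearZ /= grading_mono !scalerA (cardsD1 (wid i) u) iu -scaleNr exprS.
by congr (_ *: _); ring.
Qed.

Lemma grading_Tlast lam a : grading (Tlast lam a) = - Tlast lam (grading a).
Proof.
move: a; apply: mono_lin_ext => [x a b|x a b|al u hal].
- by rewrite !linearD !linearZ.
- by rewrite !linearD !linearZ.
rewrite grading_mono [Tlast lam (_ *: _)]linearZ /= !TlastE !dlast_mono.
case: ifP => [mu|_]; last by rewrite !linear0 addr0 !linear0.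
rewrite linearZ /= frakD_mono // !scalerA -scalerBl linearZ /= grading_mono !scalerA.
rewrite (cardsD1 ord_max u) mu -scaleNr exprS.
by congr (_ *: _); ring.
Qed.

(** Both summands of [rdiv] are odd, so they anticommute with the parity involution, which therefore
    preserves the kernel of [rdiv]. *)
Lemma divl_eq0 lam a : (2%:R : F) != 0 -> divl lam a = 0 <-> rdiv lam a = 0.
Proof.
move=> two; rewrite divlE; have -> : rdiv lam (grading a) = - grading (rdiv lam a).
  by rewrite !rdivE linearD /= grading_Delta grading_Tlast opprD !opprK.
split=> [/eqP|->]; last by rewrite !linear0.
rewrite scaler_eq0 (negbTE two) oppr_eq0 /= => /eqP e.
by rewrite -[rdiv lam a]gradingK e linear0.
Qed.

(** * Linearity of D_KO in its argument *)

Lemma lmulD_linear (D : 'End(O)) : linear (fun a => lmulD a D).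
Proof.
move=> x a b; apply/lfunP => c.
by rewrite !lfunE /= !lfunE /= !lfunE /= mulrDl -scalerAl.
Qed.

Lemma DKO_linear : linear (@DKO F p n t).
Proof.
have L (D : 'End(O)) x a b : lmulD (x *: a + b) D = x *: lmulD a D + lmulD b D.
  exact: lmulD_linear.
have Lh e : linear (@DKO_hom F p n t e).
  move=> x a b; rewrite /DKO_hom /TH_hom.
  have -> : \sum_(s : 'I_n + 'I_n) (-1) ^+ (mu (var2 (prime_ s)) * e)
       *: lmulD (dvar F p t (var2 (prime_ s)) (x *: a + b)) (dvar F p t (var2 s))
      = x *: (\sum_(s : 'I_n + 'I_n) (-1) ^+ (mu (var2 (prime_ s)) * e)
       *: lmulD (dvar F p t (var2 (prime_ s)) a) (dvar F p t (var2 s)))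
      + (\sum_(s : 'I_n + 'I_n) (-1) ^+ (mu (var2 (prime_ s)) * e)
       *: lmulD (dvar F p t (var2 (prime_ s)) b) (dvar F p t (var2 s))).
    rewrite scaler_sumr -big_split; apply: eq_bigr => s _ /=.
    by rewrite linearP L scalerDr !scalerA [x * _]mulrC.
  have -> : frakD F p t (x *: a + b) - 2%:R *: (x *: a + b)
     = x *: (frakD F p t a - 2%:R *: a) + (frakD F p t b - 2%:R *: b).
    by rewrite linearP /= scalerDr scalerBr !scalerA [2%:R * x]mulrC opprD addrACA.
  rewrite linearP !L !scalerDr !scalerA [x * _]mulrC.
  by rewrite /= [X in X + _ = _]addrACA [LHS]addrACA.
move=> x a b; rewrite /DKO scaler_sumr -big_split; apply: eq_bigr => e _ /=.
by rewrite par_linear Lh.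
Qed.

HB.instance Definition _ :=
  GRing.isLinear.Build F O 'End(O) _ (@DKO F p n t) DKO_linear.

Definition DKO_lfun : 'Hom(O, 'End(O)) := linfun (@DKO F p n t).

Lemma DKO_lfunE a : DKO_lfun a = DKO a.
Proof. exact: lfunE. Qed.

(** * Compatibility of T with the homotopy *)

Lemma Tlast_nabla_Delta lam q a :
  Tlast lam (nb q (Delta F p t a)) = nb q (Delta F p t (Tlast lam a)).
Proof.
rewrite !Delta_sum !linear_sum; apply: eq_bigr => i _ /=.
(* The two signs from d_(2n+1) cancel, and so do the degree shifts -2 of Delta_i and +2 of
   nabla_q. *)
rewrite !TlastE dlast_nabla dlast_Delta [nb q (- _)]linearN opprK /=.
by rewrite frakD_nabla frakD_Delta !linearB !linearZ /= !scalerN subrK.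
Qed.

(** T deletes x_(2n+1) and rescales, and neither changes the live sites. *)
Lemma dead_Tlast lam a : dead (Tlast lam a) = Tlast lam (dead a).
Proof.
move: a; apply: mono_lin_ext => [x a b|x a b|al u hal].
- by rewrite !linearD !linearZ.
- by rewrite !linearD !linearZ.
have sD : site al (u :\ ord_max) = site al u.
  by apply: eq_site => i; rewrite /live !inE wid_neq_max.
have E : Tlast lam (X al u) = if ord_max \in u then
    ((mdeg al (u :\ ord_max))%:R - n%:R * lam) * osign u ord_max
      *: X al (u :\ ord_max) else 0.
  rewrite TlastE dlast_mono; case: ifP => _; last by rewrite !linear0 addr0.
  by rewrite linearZ /= frakD_mono // !scalerA -scalerBl mulrBl [osign _ _ * _]mulrC.
rewrite dead_mono E; case: ifP => mu; last first.
  by rewrite linear0; case: (site al u) => [q|]; rewrite ?linear0 // E mu.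
rewrite linearZ /= dead_mono sD.
by case: (site al u) => [q|]; rewrite ?linear0 // ?scaler0 // E mu.
Qed.

Lemma rdiv0_decomp lam a : rdiv lam a = 0 ->
  a = dead a + (Delta F p t (contraction a) - contraction (Tlast lam a)).
Proof.
move/eqP; rewrite rdivE addr_eq0 => /eqP e.
by rewrite -linearN -e homotopy addrC subrK.
Qed.

Lemma rdiv0_dead lam a : rdiv lam a = 0 -> Tlast lam (dead a) = 0.
Proof.
move/eqP; rewrite rdivE addrC addr_eq0 => /eqP e.
by rewrite -dead_Tlast e linearN /= dead_Delta oppr0.
Qed.

(** * The elements A and B, and the vanishing of the divergence on the generators *)

Section Generators.
Variables (al : expo p t) (us : {set 'I_n}).
Local Notation m := (xmono F al us).
Local Notation alf := (fun i => al i : nat).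
Local Notation u0 := [set wid x | x in us].

Lemma expo_le i : (al i <= pii i)%N.
Proof. by rewrite -ltnS ltn_ord. Qed.

Lemma max_notin_wid : ord_max \notin u0.
Proof. by apply/imsetP => -[i _ /eqP]; rewrite max_wid. Qed.

Lemma mono_neq0 be u : (forall i, (be i <= pii i)%N) -> X be u != 0.
Proof.
move=> h; case: (mono_case F p t be u) => [[k -> _] | [_ [i]]]; last first.
  by rewrite ltnNge h.
by apply/eqP => /ffunP /(_ k); rewrite bmonoE eqxx ffunE; apply/eqP/oner_neq0.
Qed.

Lemma osign_neq0 u (y : 'I_n.+1) : osign u y != 0.
Proof. by rewrite /osign signr_eq0. Qed.

Lemma live_sets i : live alf u0 i = (i \in Iset F al us) || (i \in Itilde F al us).
Proof.
rewrite !inE /xmono Delta_mono ?expo_le // nabla_mono /live.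
case: ifP => iu /=.
  rewrite eqxx orbF lt0n; case: eqP => [_|_] /=; first by rewrite eqxx.
  rewrite scaler_eq0 negb_or osign_neq0 mono_neq0 // => l.
  exact: leq_trans (leq_subr _ _) (expo_le l).
rewrite eqxx scaler_eq0 negb_or osign_neq0 /=.
case: ltnP => h; last first.
  by rewrite (mono_oob F _ (i := i)) ?eqxx ?addn1.
apply/esym/mono_neq0 => l; case: eqP => [->|_]; first by rewrite addn1.
by rewrite addn0 expo_le.
Qed.

Lemma zd_mdeg : zd al us = mdeg alf u0.
Proof.
rewrite /zd /mdeg; congr (_ + _)%N; rewrite -sum1_card big_mkcond; apply: eq_bigr => i _.
by rewrite mem_imset_wid; case: (i \in us).
Qed.

Lemma dlast_xmono : dlast m = 0.
Proof. by rewrite /xmono dlast_mono (negbTE max_notin_wid). Qed.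

Lemma xmono_xlast : m * xlast = X alf (ord_max |: u0).
Proof. by rewrite mono_xlast (negbTE max_notin_wid). Qed.

Lemma Tlast_xmono lam : Tlast lam m = 0.
Proof. by rewrite TlastE dlast_xmono !linear0 addr0. Qed.

(** The scalar is minus the coefficient in B, so that Delta B can offset this term. *)
Lemma Tlast_xmono_xlast lam : Tlast lam (m * xlast) =
  - ((-1) ^+ #|us| * (n%:R * lam - (zd al us)%:R)) *: m.
Proof.
rewrite TlastE xmono_xlast dlast_mono setU11 setU1K ?max_notin_wid //.
(* Every index in u0 lies below [ord_max], so the sign counts all of [us]. *)
have -> : osign (ord_max |: u0) ord_max = (-1) ^+ #|us|.
  rewrite osignU1 ?max_notin_wid // ltnn mul1r /osign; congr (_ ^+ _).
  rewrite -(card_imset us (@wid_inj n)); apply: eq_card => l; rewrite inE.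
  case: imsetP => // -[i _ ->]; exact: (ltn_ord i).
rewrite linearZ /= frakD_mono ?zd_mdeg //; last by move=> i; apply: expo_le.
by rewrite !scalerA -scalerBl; congr (_ *: _); ring.
Qed.

Lemma Aelt_nabla_Delta q : Aelt F al us q = m - nb q (Delta F p t m).
Proof.
rewrite /Aelt Delta_sum; congr (_ - _); rewrite linear_sum.
rewrite (eq_bigr (fun i => nb q (dl i m))) => [|i _]; last by rewrite comp_lfunE.
rewrite big_mkcond; apply: eq_bigr => i _ /=; case: ifP => //.
by rewrite inE => /negbFE/eqP ->; rewrite linear0.
Qed.

Lemma Aelt_Delta q : q \in Itilde F al us -> Aelt F al us q = Delta F p t (nb q m).
Proof.
move=> hq; have := @Delta_nabla q alf u0 expo_le.
rewrite live_sets hq orbT scale1r Aelt_nabla_Delta => e.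
by rewrite -{1}[m]e addrK.
Qed.

Lemma Delta_xmono : Iset F al us = set0 -> Delta F p t m = 0.
Proof.
move=> I0; rewrite Delta_sum big1 // => i _; apply/eqP/negbNE.
by have := in_set0 i; rewrite -I0 inE => ->.
Qed.

Lemma Aelt_Iset0 q : Iset F al us = set0 -> Aelt F al us q = m.
Proof. by move=> /Delta_xmono e; rewrite Aelt_nabla_Delta e linear0 subr0. Qed.

Lemma rdiv_xmono lam : Iset F al us = set0 -> rdiv lam m = 0.
Proof. by move=> I0; rewrite rdivE Tlast_xmono Delta_xmono // addr0. Qed.

Lemma Delta_mul_xlast a : Delta F p t (a * xlast) = Delta F p t a * xlast.
Proof.
by rewrite !Delta_sum mulr_suml; apply: eq_bigr => i _; rewrite Delta_xlast.
Qed.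

Lemma rdiv_xmono_xlast lam : Iset F al us = set0 ->
  n%:R * lam - (zd al us)%:R = 0 -> rdiv lam (m * xlast) = 0.
Proof.
move=> I0 z0; rewrite rdivE Tlast_xmono_xlast z0 mulr0 oppr0 scale0r addr0.
by rewrite Delta_mul_xlast Delta_xmono // mul0r.
Qed.

(** A lies in the image of Delta, and Delta^2 = 0. T commutes with nabla_q Delta and kills m, hence
    kills A = m - nabla_q Delta m. *)
Lemma rdiv_Aelt lam q : (2%:R : F) != 0 -> q \in Itilde F al us ->
  rdiv lam (Aelt F al us q) = 0.
Proof.
move=> two hq; rewrite rdivE {1}Aelt_Delta // Delta_Delta // add0r Aelt_nabla_Delta linearB /=.
by rewrite Tlast_nabla_Delta Tlast_xmono !linear0 addr0.
Qed.

(** Applying 1 - nabla_q Delta to T (m x_(2n+1)) shows that T (A x_(2n+1)) is a multiple of A =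
    Delta (nabla_q m). Delta B is the opposite multiple, and the two remaining terms vanish. *)
Lemma rdiv_Aelt_xlast lam q : (2%:R : F) != 0 -> q \in Itilde F al us ->
  rdiv lam (Aelt F al us q * xlast + Belt al us lam q) = 0.
Proof.
move=> two hq; rewrite rdivE !linearD /= Delta_mul_xlast {1}Aelt_Delta //.
rewrite Delta_Delta // mul0r add0r.
have -> : Tlast lam (Belt al us lam q) = 0.
  rewrite /Belt linearZ /= TlastE dlast_nabla dlast_xmono.
  by rewrite !(linear0, oppr0, addr0, subr0).
have -> : Aelt F al us q * xlast = m * xlast - nb q (Delta F p t (m * xlast)).
  by rewrite Aelt_nabla_Delta mulrBl -nabla_xlast Delta_mul_xlast.
rewrite addr0 linearB /= Tlast_nabla_Delta Tlast_xmono_xlast 3!linearZ /=.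
by rewrite -scalerBr -Aelt_nabla_Delta Aelt_Delta // scaleNr addrN.
Qed.

End Generators.

Lemma bidx_xmono (k : bidx p t) : exists us : {set 'I_n},
  if ord_max \in k.2 then bmono F k = xmono F k.1 us * xlast
  else bmono F k = xmono F k.1 us.
Proof.
pose us := [set i | wid i \in k.2]; exists us.
have E l : l != ord_max -> (l \in [set wid x | x in us]) = (l \in k.2).
  move=> lm; have hl : (l < n)%N.
    by move: lm; rewrite -val_eqE /= => lm; have := ltn_ord l; rewrite ltnS leq_eqVlt (negbTE lm).
  have -> : l = wid (Ordinal hl) by apply: val_inj.
  by rewrite mem_imset_wid inE.
case: ifP => mk; rewrite ?xmono_xlast /xmono /bmono; congr (X _ _);
  apply/setP => l; rewrite ?in_setU1.
  by case: (eqVneq l ord_max) => [->|/E ->].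
case: (eqVneq l ord_max) => [->|/E -> //].
by rewrite mk (negbTE (max_notin_wid _)).
Qed.

End Relations.

(** * Solutions of the divergence equation as combinations of generators *)

Section Generators.
Variables (F : fieldType) (p n : nat) (t : 'I_n -> nat) (lam : F).
Local Notation O := (superO F p t).
Local Notation nb := (nabla F p t).
Local Notation xlast := (xvar F p t (vlast n)).
Local Notation site := (@site p n t).
Local Notation contr := (contraction F p t).
Local Notation dead := (dead F p t).
Local Notation T := (Tlast p t lam).

Definition gens (E : 'End(O)) : Prop :=
  E = DKO 1 \/ S1 E \/ S2 E \/ S3 lam E \/ S4 lam E \/ S5 lam E.

(** This operator fixes every solution of [rdiv] a = 0. Being linear on the whole algebra, it can be
    evaluated on the monomials of a solution, which need not be solutions themselves. *)
Definition resolve : 'End(O) :=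
  (dead + ((Delta F p t \o contr) - (contr \o T)))%VF.

Lemma resolveE a : resolve a = dead a + (Delta F p t (contr a) - contr (T a)).
Proof. by rewrite !add_lfunE opp_lfunE !comp_lfunE. Qed.

Section Monomial.
Variables (al : expo p t) (us : {set 'I_n}).
Local Notation m := (xmono F al us).
Local Notation alf := (fun i => al i : nat).
Local Notation u0 := [set wid x | x in us].

Lemma site_max : site alf (ord_max |: u0) = site alf u0.
Proof.
by apply: eq_site => i; rewrite /live in_setU1 (negbTE (wid_neq_max i)).
Qed.

Lemma resolve_xmono : resolve m =
  if site alf u0 is Some q then Delta F p t (nb q m) else m.
Proof.
rewrite resolveE Tlast_xmono linear0 subr0 /xmono dead_mono contraction_mono.
by case: (site _ _) => [q|]; rewrite ?add0r // linear0 addr0.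
Qed.

Lemma dead_xmono_xlast : dead (m * xlast) =
  if site alf u0 is Some q then 0 else m * xlast.
Proof. by rewrite xmono_xlast dead_mono site_max. Qed.

Lemma resolve_xmono_xlast : resolve (m * xlast) =
  if site alf u0 is Some q
  then Delta F p t (nb q m) * xlast + Belt al us lam q else m * xlast.
Proof.
rewrite resolveE Tlast_xmono_xlast dead_xmono_xlast linearZ /= scaleNr opprK.
have -> : contr m = if site alf u0 is Some q then nb q m else 0.
  exact: contraction_mono.
have -> : contr (m * xlast) =
    if site alf u0 is Some q then nb q m * xlast else 0.
  rewrite xmono_xlast contraction_mono site_max -xmono_xlast.
  by case: (site _ _) => // q; rewrite nabla_xlast.
case: (site _ _) => [q|]; last by rewrite !(linear0, addr0).
by rewrite add0r Delta_mul_xlast.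
Qed.

Lemma nabla_Itilde q : (q \in Itilde F al us) = false -> nb q m = 0.
Proof. by rewrite inE => /negbFE/eqP. Qed.

Lemma site_None_sets : site alf u0 = None ->
  Iset F al us = set0 /\ Itilde F al us = set0.
Proof.
move=> s0; split; apply/setP => i; rewrite in_set0;
  have := live_sets F al us i; rewrite (site_none i s0) => /esym/norP[h h'];
  exact/negbTE.
Qed.

Lemma site_qmin q : site alf u0 = Some q -> q \in Itilde F al us ->
  is_qmin F al us q.
Proof.
move=> /site_some[_ h] hq; split=> // i hi; apply: h.
by rewrite (live_sets F) hi orbT.
Qed.

Lemma gens_Iset0 : Iset F al us = set0 -> gens (DKO m).
Proof.
move=> I0; case: (eqVneq (al, us) (expo0 p t, set0)) => [[-> ->]|h].
  (* The monomial excluded from S1 is 1. *)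
  left; congr DKO; rewrite /xmono imset0; apply: eq_mono => i.
  by rewrite ffunE.
by right; left; exists al, us; split; [exact: I0 | apply/eqP | reflexivity].
Qed.

Lemma gens_Dstar q : Iset F al us != set0 -> q \in Itilde F al us ->
  Dstar F al us.
Proof. by move=> I0 hq; rewrite /Dstar I0 /=; apply/set0Pn; exists q. Qed.

Lemma gens_xmono : in_span gens (DKO (resolve m)).
Proof.
rewrite resolve_xmono; case s: (site _ _) => [q|]; last first.
  by apply: mem_in_span; apply: gens_Iset0; have [] := site_None_sets s.
(* A least live site outside [Itilde] lies in [Iset] and already carries x_q'. Then nabla_q m = 0
   and the monomial contributes nothing. *)
case hq: (q \in Itilde F al us); last first.
  by rewrite nabla_Itilde // raddf0 raddf0; apply: in_span0.
rewrite -Aelt_Delta //; apply: mem_in_span.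
case: (eqVneq (Iset F al us) set0) => [I0|I0].
  by rewrite Aelt_Iset0 //; apply: gens_Iset0.
by right; right; left; exists al, us, q; split; [exact: gens_Dstar hq | exact: hq | reflexivity].
Qed.

(** Here [c] stands for the coefficient of the monomial in a solution. The condition on it has force
    only without live sites, where it yields n lam = zd, as S5 requires. *)
Lemma gens_xmono_xlast c : (c != 0 -> T (dead (m * xlast)) = 0) ->
  in_span gens (c *: DKO (resolve (m * xlast))).
Proof.
rewrite resolve_xmono_xlast dead_xmono_xlast.
case s: (site _ _) => [q|] h.
  apply: in_spanZ; case hq: (q \in Itilde F al us); last first.
    have -> : Delta F p t (nb q m) * xlast + Belt al us lam q = 0.
      rewrite /Belt nabla_Itilde //.
      rewrite [Delta F p t 0]linear0.
      rewrite mul0r.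
      rewrite scaler0.
      by rewrite addr0.
    rewrite [DKO 0]raddf0.
    exact: in_span0.
  rewrite -Aelt_Delta //; apply: mem_in_span; right; right; right.
  case: (eqVneq (Iset F al us) set0) => [I0|I0].
    left; exists al, us, q; rewrite Aelt_Iset0 //.
    (* Since q is least among all live sites and lies in [Itilde], it is the minimum that S3
       prescribes. *)
    split; [exact: I0 | by apply/set0Pn; exists q | exact: site_qmin | reflexivity].
  by right; left; exists al, us, q; split; [exact: gens_Dstar hq | exact: hq | reflexivity].
case: (eqVneq c 0) => [->|/h]; first by rewrite scale0r; apply: in_span0.
rewrite Tlast_xmono_xlast => /eqP.
rewrite scaler_eq0 (negbTE (mono_neq0 _ _ (expo_le al))) orbF oppr_eq0.
rewrite mulf_eq0 signr_eq0 /= => /eqP z0.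
have [I0 J0] := site_None_sets s.
by apply/in_spanZ/mem_in_span; do 5!right; exists al, us.
Qed.

(** T strips x_(2n+1). Multiplying it back gives an operator diagonal on monomials, so T (P a) = 0
    can be read off one coefficient at a time. *)
Lemma Tlast_dead_diag : exists c, T (dead (m * xlast)) * xlast = c *: (m * xlast).
Proof.
rewrite dead_xmono_xlast; case: (site _ _) => [q|].
  by exists 0; rewrite linear0 mul0r scale0r.
rewrite Tlast_xmono_xlast -scalerAl; by eexists.
Qed.
End Monomial.

Lemma Tlast_dead_bmono (k l : bidx p t) : l != k ->
  (T (dead (bmono F l)) * xlast) k = 0.
Proof.
move=> lk; have [us] := bidx_xmono F l; case: ifP => _ e; last first.
  rewrite e /xmono dead_mono; case: (site _ _) => [q|].
    by rewrite linear0 mul0r ffunE.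
  by rewrite Tlast_xmono mul0r ffunE.
have [c] := Tlast_dead_diag l.1 us; rewrite -e => ->.
by rewrite ffunE bmonoE eq_sym (negbTE lk) scaler0.
Qed.

Lemma gens_bmono a k : rdiv p t lam a = 0 ->
  in_span gens ((a k : F) *: DKO (resolve (bmono F k))).
Proof.
move=> /rdiv0_dead a0; have [us] := bidx_xmono F k; case: ifP => _ e.
  rewrite e; apply: gens_xmono_xlast => ak; rewrite -e.
  have : (T (dead a) * xlast) k = 0 by rewrite a0 mul0r ffunE.
  (* Only the k-th monomial of [a] contributes to the k-th coefficient, so its diagonal scalar is 0
     because [a k] is not. *)
  rewrite -[a in dead a]lext_bmono /lext !linear_sum mulr_suml sum_ffunE.
  rewrite (bigD1 k) //= big1 => [|l lk]; last first.
    by rewrite !linearZ /= -scalerAl ffunE Tlast_dead_bmono // scaler0.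
  rewrite addr0 !linearZ /= -scalerAl ffunE => /eqP; rewrite scaler_eq0 (negbTE ak) /=.
  rewrite e dead_xmono_xlast; case: (site _ _) => [q|]; first by rewrite linear0.
  rewrite Tlast_xmono_xlast -scalerAl -e ffunE bmonoE eqxx.
  by rewrite scaler_eq0 oner_eq0 orbF => /eqP ->; rewrite scale0r.
by apply: in_spanZ; rewrite e; apply: gens_xmono.
Qed.

Lemma rdiv0_gens a : rdiv p t lam a = 0 -> in_span gens (DKO a).
Proof.
move=> a0; have -> : a = resolve a by rewrite resolveE; apply: rdiv0_decomp.
rewrite -[a in resolve a]lext_bmono /lext [resolve _]linear_sum -DKO_lfunE linear_sum /=.
apply: in_span_sum => k; rewrite [resolve _]linearZ linearZ /= DKO_lfunE.
exact: gens_bmono.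
Qed.

(** * The converse inclusion and the conclusion *)

Lemma gens_rdiv0 E : (2%:R : F) != 0 -> gens E -> exists2 a, rdiv p t lam a = 0 & E = DKO a.
Proof.
move=> two [->|[|[|[|[]]]]].
- exists 1 => //; have -> : (1 : O) = xmono F (expo0 p t) set0.
    by rewrite /xmono imset0; apply: eq_mono => i; rewrite ffunE.
  apply: rdiv_xmono; apply/setP => i; rewrite !inE; apply/negbTE/negPn/eqP.
  by rewrite Delta_mono ?imset0 ?inE // ffunE.
- by case=> al [us [I0 _ ->]]; exists (xmono F al us) => //; apply: rdiv_xmono.
- case=> al [us [q [_ hq ->]]]; exists (Aelt F al us q) => //.
  exact: rdiv_Aelt.
(* When I is empty, A = m, so the elements of S3 have the form of those of S4. *)
- case=> al [us [q [I0 _ [hq _] ->]]]; rewrite -(Aelt_Iset0 q I0).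
  by eexists; last reflexivity; apply: rdiv_Aelt_xlast.
- case=> al [us [q [_ hq ->]]].
  by eexists; last reflexivity; apply: rdiv_Aelt_xlast.
- case=> al [us [I0 _ z0 ->]].
  by eexists; last reflexivity; apply: rdiv_xmono_xlast.
Qed.

End Generators.

Theorem theorem2p1 (F : fieldType) (p n : nat) (t : 'I_n -> nat) (lam : F)
    (hchar : p \in [pchar F]) (hp : (3 < p)%N) (hn : (3 <= n)%N)
    (ht : forall i, (0 < t i)%N) (D : 'End(superO F p t)) :
  SKO2 lam D <->
  in_span (fun E : 'End(superO F p t) =>
    E = DKO 1 \/ S1 E \/ S2 E \/ S3 lam E \/ S4 lam E \/ S5 lam E) D.
Proof.
have two : (2%:R : F) != 0.
  rewrite -(dvdn_pcharf hchar); apply/negP => /dvdn_leq; lia.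
split=> [[a /divl_eq0 a0 ->]|]; first exact/rdiv0_gens/a0.
(* The image of the kernel of [rdiv] under D_KO is a subspace, so it contains the span once it
   contains the generators. *)
move=> /(in_span_sub (U := DKO_lfun F p t @: lker (rdiv p t lam)))%VS.
case/(_ _)/memv_imgP => [w /(gens_rdiv0 two)[a a0 ->]|a].
  rewrite -DKO_lfunE; apply: memv_img; by rewrite memv_ker a0.
rewrite memv_ker DKO_lfunE => /eqP a0 ->.
by exists a; first exact/divl_eq0.
Qed.
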